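(* Let $\beta\in\mathbb{D}$, let $$\mathcal{T}=\{(2\lambda,\lambda^2):\lambda\in\mathbb{D}\}\cup\{(\beta+\bar\beta\lambda,\lambda):\lambda\in\mathbb{D}\}\subset\mathbb{G}_2,$$ and let $a\in\mathcal{T}$. Then there is no linear isometric extension operator from $\mathscr{S}_a(\mathcal{T})$ to $\mathscr{S}(\mathbb{G}_2)$.
   Context: $\mathbb{D}$ is the open unit disk in $\mathbb{C}$, and $\mathbb{G}_2=\{(z+w,zw):z,w\in\mathbb{D}\}\subset\mathbb{C}^2$ is the symmetrized bidisc. A holomorphic function on $\mathcal{T}$ is a function that locally agrees with the restriction to $\mathcal{T}$ of a holomorphic function defined on an open set in $\mathbb{C}^2$. For $X=\mathcal{T}$ or $X=\mathbb{G}_2$, $\mathscr{S}(X)$ is the set of holomorphic functions from $X$ to the closed unit disk $\overline{\mathbb{D}}$, and $\mathscr{S}_a(X)$ is the subset of those vanishing at $a$. A linear isometric extension operator from $\mathscr{S}_a(\mathcal{T})$ to $\mathscr{S}(\mathbb{G}_2)$ means (the restriction to unit balls of) a linear map $L$ from the space of bounded holomorphic functions on $\mathcal{T}$ vanishing at $a$ to the space of bounded holomorphic functions on $\mathbb{G}_2$ such that, for all $f$, $L(f)|_{\mathcal{T}}=f$ and $\sup_{\mathbb{G}_2}|L(f)|=\sup_{\mathcal{T}}|f|$. *)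

(* Defs.v *)
From Stdlib Require Import Reals.
From Coquelicot Require Import Coquelicot.
Open Scope C_scope.

(* A function on X ⊂ C² is represented by a total function on [C * C], of which
   only the values on X matter. *)
Definition eq_on (X : C * C -> Prop) (f g : C * C -> C) : Prop :=
  forall p, X p -> f p = g p.

Definition unit_disk (z : C) : Prop := (Cmod z < 1)%R.

Definition sym_bidisc (p : C * C) : Prop :=
  exists z w : C, unit_disk z /\ unit_disk w /\ p = (z + w, z * w).

Definition tee (beta : C) (p : C * C) : Prop :=
  (exists l : C, unit_disk l /\ p = (2 * l, l * l)) \/
  (exists l : C, unit_disk l /\ p = (beta + Cconj beta * l, l)).

(* Meant for open U. The normed spaces are taken over [C_AbsRing], so the
   differential is C-linear. *)
Definition holomorphic_open (U : C * C -> Prop) (f : C * C -> C) : Prop :=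
  forall p : C * C, U p ->
    ex_filterdiff (K := C_AbsRing)
      (U := prod_NormedModule C_AbsRing C_NormedModule C_NormedModule)
      (V := C_NormedModule)
      f (locally p).

Definition holomorphic_sub (X : C * C -> Prop) (f : C * C -> C) : Prop :=
  forall p : C * C, X p ->
    exists (U : C * C -> Prop) (F : C * C -> C),
      open U /\ U p /\ holomorphic_open U F /\
      eq_on (fun q => X q /\ U q) f F.

Definition bounded_on (X : C * C -> Prop) (f : C * C -> C) : Prop :=
  exists M : R, forall p, X p -> (Cmod (f p) <= M)%R.

Definition sup_norm (X : C * C -> Prop) (f : C * C -> C) : Rbar :=
  Lub_Rbar (fun r : R => exists p, X p /\ r = Cmod (f p)).

Definition Hinf_tee_at (beta : C) (a : C * C) (f : C * C -> C) : Prop :=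
  holomorphic_sub (tee beta) f /\ bounded_on (tee beta) f /\ f a = 0.

Definition Hinf_sym_bidisc (f : C * C -> C) : Prop :=
  holomorphic_open sym_bidisc f /\ bounded_on sym_bidisc f.

(* [L] is unconstrained outside [Hinf_tee_at beta a]. The field [lie_ext] makes
   it a map of functions on the set [tee beta] rather than of their
   representatives. *)
Record linear_isometric_extension (beta : C) (a : C * C)
    (L : (C * C -> C) -> (C * C -> C)) : Prop := {
  lie_ext : forall f g, Hinf_tee_at beta a f -> Hinf_tee_at beta a g ->
    eq_on (tee beta) f g -> eq_on sym_bidisc (L f) (L g);
  lie_maps : forall f, Hinf_tee_at beta a f -> Hinf_sym_bidisc (L f);
  lie_add : forall f g, Hinf_tee_at beta a f -> Hinf_tee_at beta a g ->
    eq_on sym_bidisc (L (fun p => f p + g p)) (fun p => L f p + L g p);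
  lie_scal : forall (c : C) f, Hinf_tee_at beta a f ->
    eq_on sym_bidisc (L (fun p => c * f p)) (fun p => c * L f p);
  lie_restr : forall f, Hinf_tee_at beta a f -> eq_on (tee beta) (L f) f;
  lie_isometric : forall f, Hinf_tee_at beta a f ->
    sup_norm sym_bidisc (L f) = sup_norm (tee beta) f
}.

(* Main.v *)
Require Import Defs.
From Stdlib Require Import Reals Lra Lia ClassicalEpsilon.
From Coquelicot Require Import Coquelicot.
Open Scope C_scope.

(* An automorphism of the symmetrized bidisc reduces to [beta = 0], where the two disks
   are the royal variety {(2 l, l^2)} and {(0, m)}. Take [f] vanishing on the second disk,
   with nonzero derivative at 0 along the first one, and [h] vanishing on the first disk and
   equal to [m ^ k] on the second one, up to an error of size |m0|^(k-1) needed to make it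
   vanish when a = (0, m0). Then |f + w h| <= 1 for all unimodular [w], so by linearity the
   extensions satisfy |A| + |B| <= 1. Now compare Taylor coefficients in [l], for real [x]:
   the first coefficient of A (l x, l^2) is proportional to [x], so the coefficient of order
   2k of B (l x, l^2), almost unimodular at x = 0, drops at least linearly in |x|. But by
   Cauchy's estimates its second difference at x = 0 is of order x^2 r^(-2k) for any fixed
   radius [r]. If r^2 > |m0|, the error is negligible against r^(2k) and this is absurd for
   large [k]. *)

(** * Complex differentiability *)

(** The two estimates live on different slices. For real x with |x| <= 2 the roots of z^2 - x z + 1
    are unimodular, so (l x, l^2) stays in the domain for every l in the unit disk and coefficients
    are bounded by 1 without loss; the linear drop tolerates no loss. The quadratic estimate needs
    complex x near 0, and then l is confined to a circle |l| = r with |x| < 1/r - r: this is where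
    the factor r^(-2k) arises, and why the error must decay faster than r^(2k), with r fixed before
    k grows. The order 2k reflects m = l^2 on the slice x = 0. Orders 1 and 2k are compared after
    multiplying the first function by l^(2k-1), which does not increase its modulus. Cauchy's
    estimates come from Goursat's theorem on rectangles: in the logarithmic coordinate, circles
    around 0 become vertical sides, and integrals over two circles are compared without any contour
    theory. *)

Lemma continuous_C_components {U : UniformSpace} (f : U -> C) (x : U) :
  continuous (fun t => fst (f t)) x -> continuous (fun t => snd (f t)) x ->
  continuous (f : U -> C_UniformSpace) x.
Proof.
  intros H1 H2.
  apply (continuous_ext (fun t => (fst (f t), snd (f t)))).
  { intro t; now destruct (f t). }
  apply (continuous_comp_2 (fun t => fst (f t)) (fun t => snd (f t)) (fun a b => (a, b)));
    try assumption.
  apply (continuous_ext (fun z : prod_UniformSpace R_UniformSpace R_UniformSpace => z)).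
  { now intros []. }
  apply continuous_id.
Qed.

Lemma continuous_C_fst {U : UniformSpace} (f : U -> C) (x : U) :
  continuous (f : U -> C_UniformSpace) x -> continuous (fun t => fst (f t)) x.
Proof.
  intro H. apply (continuous_comp (V := C_UniformSpace) f fst); [exact H |].
  apply continuous_fst.
Qed.

Lemma continuous_C_snd {U : UniformSpace} (f : U -> C) (x : U) :
  continuous (f : U -> C_UniformSpace) x -> continuous (fun t => snd (f t)) x.
Proof.
  intro H. apply (continuous_comp (V := C_UniformSpace) f snd); [exact H |].
  apply continuous_snd.
Qed.

Lemma continuous_Cplus {U : UniformSpace} (f g : U -> C_UniformSpace) (x : U) :
  continuous f x -> continuous g x ->
  continuous (fun t => Cplus (f t) (g t) : C_UniformSpace) x.
Proof.
  intros Hf Hg; apply continuous_C_components; simpl;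
    apply (continuous_plus (V := R_NormedModule));
    auto using continuous_C_fst, continuous_C_snd.
Qed.

Lemma continuous_Cmult {U : UniformSpace} (f g : U -> C_UniformSpace) (x : U) :
  continuous f x -> continuous g x ->
  continuous (fun t => Cmult (f t) (g t) : C_UniformSpace) x.
Proof.
  intros Hf Hg; apply continuous_C_components; simpl.
  - apply (continuous_minus (V := R_NormedModule));
      apply (continuous_mult (K := R_AbsRing));
      auto using continuous_C_fst, continuous_C_snd.
  - apply (continuous_plus (V := R_NormedModule));
      apply (continuous_mult (K := R_AbsRing));
      auto using continuous_C_fst, continuous_C_snd.
Qed.

Lemma continuous_Copp {U : UniformSpace} (f : U -> C_UniformSpace) (x : U) :
  continuous f x -> continuous (fun t => Copp (f t) : C_UniformSpace) x.
Proof.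
  intros Hf; apply continuous_C_components; simpl;
    apply (continuous_opp (V := R_NormedModule));
    auto using continuous_C_fst, continuous_C_snd.
Qed.

Lemma continuous_Cinv {U : UniformSpace} (f : U -> C_UniformSpace) (x : U) :
  continuous f x -> f x <> RtoC 0 -> continuous (fun t => Cinv (f t) : C_UniformSpace) x.
Proof.
  intros Hf Hn.
  assert (Hs : (fst (f x) ^ 2 + snd (f x) ^ 2)%R <> 0%R).
  { intro E. apply Hn. apply Cmod_eq_0. unfold Cmod. rewrite E. apply sqrt_0. }
  assert (Hc : continuous (fun t => (fst (f t) ^ 2 + snd (f t) ^ 2)%R) x).
  { apply (continuous_ext (fun t => (fst (f t) * fst (f t) + snd (f t) * snd (f t))%R)).
    { intro t. simpl. ring. }
    apply (continuous_plus (V := R_NormedModule));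
      apply (continuous_mult (K := R_AbsRing));
      auto using continuous_C_fst, continuous_C_snd. }
  assert (Hi : continuous (fun t => (/ (fst (f t) ^ 2 + snd (f t) ^ 2))%R) x).
  { apply (continuous_comp (fun t => (fst (f t) ^ 2 + snd (f t) ^ 2)%R) Rinv); auto.
    apply continuous_Rinv; exact Hs. }
  apply continuous_C_components; unfold Cinv, Rdiv; cbn [fst snd];
    apply (continuous_mult (K := R_AbsRing)); auto using continuous_C_fst.
  apply (continuous_opp (V := R_NormedModule)). auto using continuous_C_snd.
Qed.

Lemma continuous_Cpair {U V W : UniformSpace} (f : U -> V) (g : U -> W) (x : U) :
  continuous f x -> continuous g x ->
  continuous (fun t => (f t, g t) : prod_UniformSpace V W) x.
Proof.
  intros Hf Hg.
  apply (continuous_comp_2 f g (fun a b => (a, b))); auto.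
  apply (continuous_ext (fun z : prod_UniformSpace V W => z)).
  { now intros []. }
  apply continuous_id.
Qed.

(** * Moduli and neighbourhoods in the complex plane *)

Lemma Rabs_fst_le_Cmod (z : C) : (Rabs (fst z) <= Cmod z)%R.
Proof. eapply Rle_trans; [apply Rmax_l | apply Rmax_Cmod]. Qed.

Lemma Rabs_snd_le_Cmod (z : C) : (Rabs (snd z) <= Cmod z)%R.
Proof. eapply Rle_trans; [apply Rmax_r | apply Rmax_Cmod]. Qed.

Lemma Cmod_le_components (z : C) : (Cmod z <= Rabs (fst z) + Rabs (snd z))%R.
Proof.
  replace z with (RtoC (fst z) + Ci * RtoC (snd z)) at 1.
  - eapply Rle_trans; [apply Cmod_triangle |].
    rewrite Cmod_mult, Cmod_Ci, !Cmod_R. lra.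
  - destruct z; unfold RtoC, Ci, Cplus, Cmult; simpl; f_equal; ring.
Qed.

Lemma Cmod_minus_lt_ball (z w : C) (e : posreal) :
  (Cmod (w - z) < e)%R -> @ball C_UniformSpace z e w.
Proof. apply C_NormedModule_mixin_compat1. Qed.

(** Balls of [C_UniformSpace] are squares: each coordinate is within the radius. Halving the radius
    absorbs the sum of the two coordinates. *)
Lemma ball_Cmod_minus_lt (z w : C) (e : R) (He : (0 < e / 2)%R) :
  @ball C_UniformSpace z (mkposreal _ He) w -> (Cmod (w - z) < e)%R.
Proof.
  intros [H1 H2].
  change (Rabs (fst w - fst z) < e / 2)%R in H1.
  change (Rabs (snd w - snd z) < e / 2)%R in H2.
  eapply Rle_lt_trans; [apply Cmod_le_components |].
  simpl. unfold Rminus in *. lra.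
Qed.

Lemma continuous_to_C_eps {U : UniformSpace} (f : U -> C_UniformSpace) (x : U) :
  continuous f x <-> forall e : R, (0 < e)%R -> locally x (fun t => (Cmod (f t - f x) < e)%R).
Proof.
  split.
  - intros H e He.
    assert (He2 : (0 < e / 2)%R) by lra.
    apply filterlim_locally with (eps := mkposreal _ He2) in H.
    revert H; apply filter_imp. intros t. apply ball_Cmod_minus_lt.
  - intros H. apply filterlim_locally. intros eps.
    generalize (H eps (cond_pos eps)); apply filter_imp. intros t.
    apply Cmod_minus_lt_ball.
Qed.

Lemma locally_C_Cmod (z : C) (P : C -> Prop) :
  @locally C_UniformSpace z P <->
  exists d, (0 < d)%R /\ forall w, (Cmod (w - z) < d)%R -> P w.
Proof.
  split.
  - intros [d Hd]. exists d; split; [apply cond_pos |].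
    intros w Hw. apply Hd, Cmod_minus_lt_ball, Hw.
  - intros [d [Hd H]]. assert (H2 : (0 < d / 2)%R) by lra.
    exists (mkposreal _ H2). intros w Hw. apply H. eapply ball_Cmod_minus_lt, Hw.
Qed.

(* Complex differentiability in Caratheodory's form: the increment factors through
   difference quotients that are continuous at the point. *)
Definition cderiv (f : C -> C) (z d : C) : Prop :=
  exists phi : C -> C, continuous (T := C_UniformSpace) (U := C_UniformSpace) phi z /\
    phi z = d /\ forall w, f w = f z + phi w * (w - z).

Definition cdiff (f : C -> C) (z : C) : Prop := exists d, cderiv f z d.

(** In two variables [phi] and [psi] are not determined by [F], but their values at [q] are: moving
    one coordinate at a time shows that they are the partial derivatives. *)
Definition cderiv2 (F : C * C -> C) (q : C * C) (a b : C) : Prop :=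
  exists phi psi : C * C -> C,
    continuous (T := prod_UniformSpace C_UniformSpace C_UniformSpace)
      (U := C_UniformSpace) phi q /\
    continuous (T := prod_UniformSpace C_UniformSpace C_UniformSpace)
      (U := C_UniformSpace) psi q /\
    phi q = a /\ psi q = b /\
    forall q', F q' = F q + phi q' * (fst q' - fst q) + psi q' * (snd q' - snd q).

Definition cdiff2 (F : C * C -> C) (q : C * C) : Prop := exists a b, cderiv2 F q a b.

Lemma cderiv_continuous f z d :
  cderiv f z d -> continuous (T := C_UniformSpace) (U := C_UniformSpace) f z.
Proof.
  intros (phi & Hc & _ & H).
  apply (continuous_ext (fun w => f z + phi w * (w + - z) : C_UniformSpace)).
  { intro w. now rewrite (H w). }
  apply continuous_Cplus; [apply continuous_const |].
  apply continuous_Cmult; [exact Hc |].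
  apply continuous_Cplus; [apply continuous_id | apply continuous_const].
Qed.

Lemma cdiff_continuous f z :
  cdiff f z -> continuous (T := C_UniformSpace) (U := C_UniformSpace) f z.
Proof. intros [d H]; eapply cderiv_continuous, H. Qed.

Lemma cdiff2_continuous F q :
  cdiff2 F q -> continuous (T := prod_UniformSpace C_UniformSpace C_UniformSpace)
    (U := C_UniformSpace) F q.
Proof.
  intros (a & b & phi & psi & Hphi & Hpsi & _ & _ & H).
  apply (continuous_ext (fun q' : prod_UniformSpace C_UniformSpace C_UniformSpace =>
    (F q + phi q' * (fst q' + - fst q)) + psi q' * (snd q' + - snd q) : C_UniformSpace)).
  { intro w. now rewrite (H w). }
  apply continuous_Cplus; [apply continuous_Cplus; [apply continuous_const |] |];
    apply continuous_Cmult; trivial;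
    (apply continuous_Cplus; [| apply continuous_const]).
  - apply continuous_fst.
  - apply continuous_snd.
Qed.

(** With factored increments the chain rule is a substitution followed by continuity of the factors;
    no remainder has to be estimated. *)
Lemma cderiv_comp2 F g h z a b dg dh :
  cderiv2 F (g z, h z) a b -> cderiv g z dg -> cderiv h z dh ->
  cderiv (fun w => F (g w, h w)) z (a * dg + b * dh).
Proof.
  intros (phi & psi & Hphi & Hpsi & Ea & Eb & HF) Hg Hh.
  pose proof (cderiv_continuous _ _ _ Hg) as Cg.
  pose proof (cderiv_continuous _ _ _ Hh) as Ch.
  destruct Hg as (pg & Hpg & Eg & Hg). destruct Hh as (ph & Hph & Eh & Hh).
  exists (fun w => phi (g w, h w) * pg w + psi (g w, h w) * ph w).
  assert (Cp : continuous (T := C_UniformSpace)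
    (U := prod_UniformSpace C_UniformSpace C_UniformSpace) (fun w => (g w, h w)) z).
  { now apply continuous_Cpair. }
  split; [| split].
  - apply continuous_Cplus; apply continuous_Cmult; trivial.
    + apply (continuous_comp (fun w : C_UniformSpace => (g w, h w)) phi); trivial.
    + apply (continuous_comp (fun w : C_UniformSpace => (g w, h w)) psi); trivial.
  - now rewrite Ea, Eb, Eg, Eh.
  - intro w. rewrite HF. simpl.
    assert (E1 : g w - g z = pg w * (w - z)) by (rewrite (Hg w); ring).
    assert (E2 : h w - h z = ph w * (w - z)) by (rewrite (Hh w); ring).
    rewrite E1, E2. ring.
Qed.

Lemma cdiff_comp2 F g h z :
  cdiff2 F (g z, h z) -> cdiff g z -> cdiff h z -> cdiff (fun w => F (g w, h w)) z.
Proof.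
  intros (a & b & HF) [dg Hg] [dh Hh]. eexists. eapply cderiv_comp2; eassumption.
Qed.

Lemma cdiff2_comp2 F G H q :
  cdiff2 F (G q, H q) -> cdiff2 G q -> cdiff2 H q -> cdiff2 (fun r => F (G r, H r)) q.
Proof.
  intros (a & b & phi & psi & Hphi & Hpsi & Ea & Eb & HF) HG HH.
  pose proof (cdiff2_continuous _ _ HG) as CG.
  pose proof (cdiff2_continuous _ _ HH) as CH.
  destruct HG as (a1 & b1 & p1 & q1 & Cp1 & Cq1 & _ & _ & HG).
  destruct HH as (a2 & b2 & p2 & q2 & Cp2 & Cq2 & _ & _ & HH).
  assert (Cp : continuous (T := prod_UniformSpace C_UniformSpace C_UniformSpace)
    (U := prod_UniformSpace C_UniformSpace C_UniformSpace) (fun w => (G w, H w)) q).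
  { now apply continuous_Cpair. }
  assert (C1 : continuous (T := prod_UniformSpace C_UniformSpace C_UniformSpace)
    (U := C_UniformSpace) (fun r => phi (G r, H r)) q).
  { apply (continuous_comp (fun w => (G w, H w)) phi); trivial. }
  assert (C2 : continuous (T := prod_UniformSpace C_UniformSpace C_UniformSpace)
    (U := C_UniformSpace) (fun r => psi (G r, H r)) q).
  { apply (continuous_comp (fun w => (G w, H w)) psi); trivial. }
  eexists _, _.
  exists (fun r => phi (G r, H r) * p1 r + psi (G r, H r) * p2 r),
         (fun r => phi (G r, H r) * q1 r + psi (G r, H r) * q2 r).
  repeat split; try (apply continuous_Cplus; apply continuous_Cmult; trivial).
  intro r. rewrite HF. simpl.
  assert (E1 : G r - G q = p1 r * (fst r - fst q) + q1 r * (snd r - snd q))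
    by (rewrite (HG r); ring).
  assert (E2 : H r - H q = p2 r * (fst r - fst q) + q2 r * (snd r - snd q))
    by (rewrite (HH r); ring).
  rewrite E1, E2. ring.
Qed.

Lemma cdiff2_const c q : cdiff2 (fun _ => c) q.
Proof.
  exists 0, 0, (fun _ => RtoC 0), (fun _ => RtoC 0).
  repeat split; try apply continuous_const. intro; ring.
Qed.

Lemma cdiff2_fst q : cdiff2 fst q.
Proof.
  exists 1, 0, (fun _ => RtoC 1), (fun _ => RtoC 0).
  repeat split; try apply continuous_const. intro; ring.
Qed.

Lemma cdiff2_snd q : cdiff2 snd q.
Proof.
  exists 0, 1, (fun _ => RtoC 0), (fun _ => RtoC 1).
  repeat split; try apply continuous_const. intro; ring.
Qed.

Lemma cdiff2_of_cdiff f (q : C * C) : cdiff f (fst q) -> cdiff2 (fun r => f (fst r)) q.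
Proof.
  intros (d & phi & Hc & E & H).
  exists d, 0, (fun r => phi (fst r)), (fun _ => RtoC 0).
  repeat split; trivial; try apply continuous_const.
  - apply (continuous_comp (U := prod_UniformSpace C_UniformSpace C_UniformSpace)
      (V := C_UniformSpace) (W := C_UniformSpace) fst phi); trivial.
    apply continuous_fst.
  - intro r. rewrite (H (fst r)). ring.
Qed.

Lemma cderiv2_Cplus (q : C * C) : cderiv2 (fun r => fst r + snd r) q 1 1.
Proof.
  exists (fun _ => RtoC 1), (fun _ => RtoC 1).
  repeat split; try apply continuous_const. intro; ring.
Qed.

Lemma cderiv2_Cmult (q : C * C) : cderiv2 (fun r => fst r * snd r) q (snd q) (fst q).
Proof.
  exists snd, (fun _ => fst q).
  repeat split; try apply continuous_const; try apply continuous_snd. intro; ring.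
Qed.

Lemma cdiff_Cinv (z : C) : z <> 0 -> cdiff Cinv z.
Proof.
  intro Hz.
  exists (- / (z * z)).
  (* The factorization must also hold at w = 0, where [Cinv] takes the value 0; this forces the
     value [/ (z * z)] there. *)
  exists (fun w => if Ceq_dec w 0 then / (z * z) else - / (z * w)).
  split; [| split].
  - apply (continuous_ext_loc (T := C_UniformSpace) (U := C_UniformSpace) _
      (fun w => - / (z * w))).
    + apply locally_C_Cmod. exists (Cmod z). split; [now apply Cmod_gt_0 |].
      intros w Hw. destruct (Ceq_dec w 0) as [-> |]; [| easy].
      exfalso. replace (0 - z) with (- z) in Hw by ring. rewrite Cmod_opp in Hw. lra.
    + apply continuous_Copp, continuous_Cinv.
      * apply continuous_Cmult; [apply continuous_const | apply continuous_id].
      * now apply Cmult_neq_0.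
  - destruct (Ceq_dec z 0); easy.
  - intro w. destruct (Ceq_dec w 0) as [-> |].
    + replace (/ 0) with (RtoC 0); [now field |].
      unfold Cinv, RtoC; simpl. f_equal; unfold Rdiv; ring.
    + now field.
Qed.

Lemma cderiv_id z : cderiv (fun w => w) z 1.
Proof.
  exists (fun _ => RtoC 1). repeat split; [apply continuous_const |]. intro; ring.
Qed.

Lemma cderiv_const c z : cderiv (fun _ => c) z 0.
Proof.
  exists (fun _ => RtoC 0). repeat split; [apply continuous_const |]. intro; ring.
Qed.

Lemma cdiff_id z : cdiff (fun w => w) z.
Proof. eexists; apply cderiv_id. Qed.

Lemma cdiff_const c z : cdiff (fun _ => c) z.
Proof. eexists; apply cderiv_const. Qed.

Lemma cdiff_plus f g z : cdiff f z -> cdiff g z -> cdiff (fun w => f w + g w) z.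
Proof.
  intros. apply (cdiff_comp2 (fun r => fst r + snd r) f g); trivial.
  eexists _, _; apply cderiv2_Cplus.
Qed.

Lemma cderiv_mult f g z df dg : cderiv f z df -> cderiv g z dg ->
  cderiv (fun w => f w * g w) z (g z * df + f z * dg).
Proof.
  intros. apply (cderiv_comp2 (fun r => fst r * snd r) f g); trivial.
  apply (cderiv2_Cmult (f z, g z)).
Qed.

Lemma cdiff_mult f g z : cdiff f z -> cdiff g z -> cdiff (fun w => f w * g w) z.
Proof. intros [df Hf] [dg Hg]. eexists; apply cderiv_mult; eassumption. Qed.

Lemma cdiff_pow f n z : cdiff f z -> cdiff (fun w => f w ^ n) z.
Proof.
  intro H. induction n as [| n IH]; simpl.
  - apply cdiff_const.
  - now apply cdiff_mult.
Qed.

Lemma cdiff_comp f g z : cdiff f (g z) -> cdiff g z -> cdiff (fun w => f (g w)) z.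
Proof.
  intros Hf Hg. apply (cdiff_comp2 (fun r => f (fst r)) g g); trivial.
  now apply cdiff2_of_cdiff.
Qed.

Lemma cdiff2_plus F G q : cdiff2 F q -> cdiff2 G q -> cdiff2 (fun r => F r + G r) q.
Proof.
  intros. apply (cdiff2_comp2 (fun r => fst r + snd r) F G); trivial.
  eexists _, _; apply cderiv2_Cplus.
Qed.

Lemma cdiff2_mult F G q : cdiff2 F q -> cdiff2 G q -> cdiff2 (fun r => F r * G r) q.
Proof.
  intros. apply (cdiff2_comp2 (fun r => fst r * snd r) F G); trivial.
  eexists _, _; apply cderiv2_Cmult.
Qed.

Lemma cdiff2_comp f G q : cdiff f (G q) -> cdiff2 G q -> cdiff2 (fun r => f (G r)) q.
Proof.
  intros Hf HG. apply (cdiff2_comp2 (fun r => f (fst r)) G G); trivial.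
  now apply cdiff2_of_cdiff.
Qed.

(** * Goursat's theorem *)

Lemma nested_intervals (u v : nat -> R) :
  (forall n, u n <= u (S n))%R -> (forall n, v (S n) <= v n)%R -> (forall n, u n <= v n)%R ->
  exists x, forall n, (u n <= x <= v n)%R.
Proof.
  intros Hu Hv Huv.
  assert (Mu : forall n m, (n <= m)%nat -> (u n <= u m)%R).
  { intros n m H; induction H; [lra | specialize (Hu m); lra]. }
  assert (Mv : forall n m, (n <= m)%nat -> (v m <= v n)%R).
  { intros n m H; induction H; [lra | specialize (Hv m); lra]. }
  assert (B : forall n m, (u n <= v m)%R).
  { intros n m. pose proof (Mu n (max n m) ltac:(lia)). pose proof (Mv m (max n m) ltac:(lia)).
    specialize (Huv (max n m)). lra. }
  destruct (completeness (fun r => exists n, r = u n)) as [x [Hx1 Hx2]].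
  - exists (v 0%nat). intros r [n ->]. apply B.
  - exists (u 0%nat). now exists 0%nat.
  - exists x. intro n. split.
    + apply Hx1. now exists n.
    + apply Hx2. intros r [m ->]. apply B.
Qed.

Lemma half_pow_lt (x e : R) : (0 < e)%R -> exists n, (x / 2 ^ n < e)%R.
Proof.
  intro He.
  destruct (pow_lt_1_zero (/ 2) ltac:(rewrite Rabs_pos_eq; lra) (e / (Rabs x + 1))) as [n Hn].
  - apply Rdiv_lt_0_compat; [exact He |]. pose proof (Rabs_pos x); lra.
  - exists n. specialize (Hn n (le_n n)).
    pose proof (Rabs_pos x) as Hx.
    assert (H2 : (0 < (/ 2) ^ n)%R) by (apply pow_lt; lra).
    rewrite Rabs_pos_eq in Hn by lra.
    unfold Rdiv at 1. rewrite <- pow_inv.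
    apply (Rmult_lt_compat_r (Rabs x + 1)) in Hn; [| lra].
    replace (e / (Rabs x + 1) * (Rabs x + 1))%R with e in Hn by (field; lra).
    pose proof (Rle_abs x). nra.
Qed.

(** If [P] fails on a rectangle, it fails on one of its quarters; the failing quarters shrink to a
    point, and the local hypothesis at that point is contradicted. *)
Lemma rect_bisection (P : R -> R -> R -> R -> Prop) (a b c d : R) :
  (a <= b)%R -> (c <= d)%R ->
  (forall a' b' c' d', (a <= a' /\ a' <= b' /\ b' <= b)%R -> (c <= c' /\ c' <= d' /\ d' <= d)%R ->
    let m := ((a' + b') / 2)%R in let n := ((c' + d') / 2)%R in
    P a' m c' n -> P m b' c' n -> P a' m n d' -> P m b' n d' -> P a' b' c' d') ->
  (forall x y, (a <= x <= b)%R -> (c <= y <= d)%R ->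
    exists e, (0 < e)%R /\
      forall a' b' c' d', (a <= a' /\ a' <= x <= b' /\ b' <= b)%R ->
        (c <= c' /\ c' <= y <= d' /\ d' <= d)%R ->
        (b' - a' < e)%R -> (d' - c' < e)%R -> P a' b' c' d') ->
  P a b c d.
Proof.
  intros Hab Hcd Hsplit Hloc.
  apply NNPP; intro Hbad.
  set (bad := fun t : R * R * R * R => let '(a', b', c', d') := t in
    (a <= a' /\ a' <= b' /\ b' <= b)%R /\ (c <= c' /\ c' <= d' /\ d' <= d)%R /\ ~ P a' b' c' d').
  set (quarter := fun t t' : R * R * R * R =>
    let '(a1, b1, c1, d1) := t in let '(a2, b2, c2, d2) := t' in
    (a1 <= a2 /\ b2 <= b1 /\ c1 <= c2 /\ d2 <= d1 /\
     b2 - a2 = (b1 - a1) / 2 /\ d2 - c2 = (d1 - c1) / 2)%R).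
  (* Failing rectangles are kept in a subset type, and the failing quarter is selected by indefinite
     description, so that the sequence [T] can be defined by recursion. *)
  assert (Step : forall t : {t | bad t}, {t' : {t | bad t} | quarter (proj1_sig t) (proj1_sig t')}).
  { intros [[[[a1 b1] c1] d1] [H1 [H2 H3]]]. apply constructive_indefinite_description.
    set (m := ((a1 + b1) / 2)%R). set (n := ((c1 + d1) / 2)%R).
    assert (Hm : (a1 <= m <= b1)%R) by (unfold m; lra).
    assert (Hn : (c1 <= n <= d1)%R) by (unfold n; lra).
    assert (Q : forall a2 b2 c2 d2, ~ P a2 b2 c2 d2 ->
      (a1 <= a2 /\ a2 <= b2 /\ b2 <= b1 /\ c1 <= c2 /\ c2 <= d2 /\ d2 <= d1 /\
      b2 - a2 = (b1 - a1) / 2 /\ d2 - c2 = (d1 - c1) / 2)%R ->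
      exists t' : {t | bad t}, quarter (a1, b1, c1, d1) (proj1_sig t')).
    { intros a2 b2 c2 d2 HP HH.
      assert (B : bad (a2, b2, c2, d2)) by (repeat split; trivial; lra).
      exists (exist _ _ B). simpl. lra. }
    simpl.
    destruct (classic (P a1 m c1 n)) as [P1 | P1]; [| apply (Q _ _ _ _ P1); unfold m, n in *; lra].
    destruct (classic (P m b1 c1 n)) as [P2 | P2]; [| apply (Q _ _ _ _ P2); unfold m, n in *; lra].
    destruct (classic (P a1 m n d1)) as [P3 | P3]; [| apply (Q _ _ _ _ P3); unfold m, n in *; lra].
    destruct (classic (P m b1 n d1)) as [P4 | P4]; [| apply (Q _ _ _ _ P4); unfold m, n in *; lra].
    exfalso; apply H3. now apply Hsplit. }
  assert (B0 : bad (a, b, c, d)) by (repeat split; trivial; lra).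
  set (T := fix T (n : nat) : {t | bad t} :=
    match n with O => exist _ _ B0 | S n => proj1_sig (Step (T n)) end).
  set (A := fun n => fst (fst (fst (proj1_sig (T n))))).
  set (B := fun n => snd (fst (fst (proj1_sig (T n))))).
  set (C := fun n => snd (fst (proj1_sig (T n)))).
  set (D := fun n => snd (proj1_sig (T n))).
  assert (HT : forall n, bad (A n, B n, C n, D n)).
  { intro n. unfold A, B, C, D. destruct (T n) as [[[[a1 b1] c1] d1] Hb]. exact Hb. }
  assert (HS : forall n, quarter (A n, B n, C n, D n) (A (S n), B (S n), C (S n), D (S n))).
  { intro n. pose proof (proj2_sig (Step (T n))) as H.
    unfold A, B, C, D. change (T (S n)) with (proj1_sig (Step (T n))).
    destruct (T n) as [[[[a1 b1] c1] d1] Hb].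
    destruct (Step _) as [[[[[a2 b2] c2] d2] Hb2] Hq]. exact H. }
  assert (HB : forall n, (B n - A n = (b - a) / 2 ^ n /\ D n - C n = (d - c) / 2 ^ n)%R).
  { induction n as [| n [IH1 IH2]].
    - unfold A, B, C, D; simpl. split; field.
    - destruct (HS n) as (_ & _ & _ & _ & E1 & E2). rewrite E1, E2, IH1, IH2. simpl.
      assert (2 ^ n <> 0)%R by (apply pow_nonzero; lra). split; field; assumption. }
  destruct (nested_intervals A B) as [x Hx].
  { intro n; destruct (HS n); tauto. }
  { intro n; destruct (HS n); tauto. }
  { intro n; destruct (HT n); tauto. }
  destruct (nested_intervals C D) as [y Hy].
  { intro n; destruct (HS n); tauto. }
  { intro n; destruct (HS n); tauto. }
  { intro n; destruct (HT n); tauto. }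
  destruct (Hloc x y) as [e [He Hl]].
  { specialize (Hx 0%nat). unfold A, B in Hx. simpl in Hx. exact Hx. }
  { specialize (Hy 0%nat). unfold C, D in Hy. simpl in Hy. exact Hy. }
  destruct (half_pow_lt (Rmax (b - a) (d - c)) e He) as [n Hn].
  assert (P2 : (0 < / 2 ^ n)%R) by (apply Rinv_0_lt_compat, pow_lt; lra).
  destruct (HT n) as (H1 & H2 & H3). destruct (HB n) as [E1 E2].
  specialize (Hx n); specialize (Hy n).
  apply H3, Hl.
  - lra.
  - lra.
  - rewrite E1. eapply Rle_lt_trans; [| exact Hn].
    apply Rmult_le_compat_r; [lra | apply Rmax_l].
  - rewrite E2. eapply Rle_lt_trans; [| exact Hn].
    apply Rmult_le_compat_r; [lra | apply Rmax_r].
Qed.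

(** * Integrals of complex-valued functions *)

Local Notation CInt := (RInt (V := C_R_CompleteNormedModule)).
Local Notation ex_CInt := (ex_RInt (V := C_R_CompleteNormedModule)).

(** In [C_R_NormedModule] the scalars are real, so linearity for a complex factor is obtained from
    the real and imaginary parts. *)
Lemma is_CInt_mult (c : C) (f : R -> C) (a b : R) (l : C) :
  is_RInt (V := C_R_NormedModule) f a b l ->
  is_RInt (V := C_R_NormedModule) (fun t => c * f t) a b (c * l).
Proof.
  intro H.
  pose proof (is_RInt_fct_extend_fst (U := R_NormedModule) (V := R_NormedModule) _ _ _ _ H) as H1.
  pose proof (is_RInt_fct_extend_snd (U := R_NormedModule) (V := R_NormedModule) _ _ _ _ H) as H2.
  apply (is_RInt_fct_extend_pair (U := R_NormedModule) (V := R_NormedModule)); simpl.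
  - apply (is_RInt_minus (V := R_NormedModule));
      apply (is_RInt_scal (V := R_NormedModule)); assumption.
  - apply (is_RInt_plus (V := R_NormedModule));
      apply (is_RInt_scal (V := R_NormedModule)); assumption.
Qed.

Lemma ex_CInt_mult (c : C) (f : R -> C) (a b : R) :
  ex_CInt f a b -> ex_CInt (fun t => c * f t) a b.
Proof. intros [l H]. exists (c * l). now apply is_CInt_mult. Qed.

Lemma CInt_mult (c : C) (f : R -> C) (a b : R) :
  ex_CInt f a b -> CInt (fun t => c * f t) a b = c * CInt f a b.
Proof.
  intro H. apply (is_RInt_unique (V := C_R_CompleteNormedModule)), is_CInt_mult.
  now apply (RInt_correct (V := C_R_CompleteNormedModule)).
Qed.

Lemma CInt_plus (f g : R -> C) (a b : R) :
  ex_CInt f a b -> ex_CInt g a b -> CInt (fun t => f t + g t) a b = CInt f a b + CInt g a b.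
Proof. intros. now apply (RInt_plus (V := C_R_CompleteNormedModule)). Qed.

Lemma CInt_minus (f g : R -> C) (a b : R) :
  ex_CInt f a b -> ex_CInt g a b -> CInt (fun t => f t - g t) a b = CInt f a b - CInt g a b.
Proof. intros. now apply (RInt_minus (V := C_R_CompleteNormedModule)). Qed.

Lemma CInt_Chasles (f : R -> C) (a b c : R) :
  ex_CInt f a b -> ex_CInt f b c -> CInt f a c = CInt f a b + CInt f b c.
Proof. intros. symmetry. now apply (RInt_Chasles (V := C_R_CompleteNormedModule)). Qed.

Lemma CInt_const (c : C) (a b : R) : CInt (fun _ => c) a b = RtoC (b - a) * c.
Proof. rewrite (RInt_const (V := C_R_CompleteNormedModule)). apply scal_R_Cmult. Qed.

Lemma CInt_norm_le (f : R -> C) (a b M : R) :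
  (a <= b)%R -> (forall x, (a <= x <= b)%R -> (Cmod (f x) <= M)%R) -> ex_CInt f a b ->
  (Cmod (CInt f a b) <= (b - a) * M)%R.
Proof.
  intros Hab HM Hex.
  rewrite Cmod_norm.
  apply (norm_RInt_le_const (V := C_R_NormedModule) f a b (CInt f a b) M Hab).
  { intros x Hx. change (@norm R_AbsRing C_R_NormedModule (f x))
      with (@norm R_AbsRing (prod_NormedModule R_AbsRing R_NormedModule R_NormedModule) (f x)).
    rewrite <- Cmod_norm. now apply HM. }
  now apply (RInt_correct (V := C_R_CompleteNormedModule)).
Qed.

Lemma CInt_continuous (f : R -> C) (a b : R) :
  (a <= b)%R ->
  (forall x, (a <= x <= b)%R -> continuous (T := R_UniformSpace) (U := C_UniformSpace) f x) ->
  ex_CInt f a b.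
Proof.
  intros Hab H. apply (ex_RInt_continuous (V := C_R_CompleteNormedModule)).
  intros z. rewrite Rmin_left, Rmax_right by exact Hab. apply H.
Qed.

(** The contour integral of g dz along the boundary of [a, b] x [c, d], counterclockwise: dz is dx
    on horizontal sides and [Ci] dy on vertical ones. *)
Definition rect_int (g : C -> C) (a b c d : R) : C :=
  CInt (fun x => g (x, c)) a b - CInt (fun x => g (x, d)) a b +
  Ci * (CInt (fun y => g (b, y)) c d - CInt (fun y => g (a, y)) c d).

Lemma continuous_horizontal (g : C -> C) (x y : R) :
  cdiff g (x, y) -> continuous (T := R_UniformSpace) (U := C_UniformSpace) (fun t => g (t, y)) x.
Proof.
  intro H. apply (continuous_comp (V := C_UniformSpace) (fun t => (t, y)) g).
  - apply continuous_C_components; simpl; [apply continuous_id | apply continuous_const].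
  - now apply cdiff_continuous.
Qed.

Lemma continuous_vertical (g : C -> C) (x y : R) :
  cdiff g (x, y) -> continuous (T := R_UniformSpace) (U := C_UniformSpace) (fun t => g (x, t)) y.
Proof.
  intro H. apply (continuous_comp (V := C_UniformSpace) (fun t => (x, t)) g).
  - apply continuous_C_components; simpl; [apply continuous_const | apply continuous_id].
  - now apply cdiff_continuous.
Qed.

Definition cdiff_rect (g : C -> C) (a b c d : R) : Prop :=
  forall x y, (a <= x <= b)%R -> (c <= y <= d)%R -> cdiff g (x, y).

Lemma ex_CInt_horizontal (g : C -> C) (a b c d x1 x2 y : R) :
  cdiff_rect g a b c d ->
  (a <= x1 /\ x1 <= x2 /\ x2 <= b)%R -> (c <= y <= d)%R -> ex_CInt (fun x => g (x, y)) x1 x2.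
Proof.
  intros Hg H1 H2. apply CInt_continuous; [lra |]. intros x Hx.
  apply continuous_horizontal, Hg; lra.
Qed.

Lemma ex_CInt_vertical (g : C -> C) (a b c d x y1 y2 : R) :
  cdiff_rect g a b c d ->
  (a <= x <= b)%R -> (c <= y1 /\ y1 <= y2 /\ y2 <= d)%R -> ex_CInt (fun y => g (x, y)) y1 y2.
Proof.
  intros Hg H1 H2. apply CInt_continuous; [lra |]. intros y Hy.
  apply continuous_vertical, Hg; lra.
Qed.

Lemma rect_int_split (g : C -> C) (a b c d a' b' c' d' m n : R) :
  cdiff_rect g a b c d ->
  (a <= a' /\ a' <= m <= b' /\ b' <= b)%R -> (c <= c' /\ c' <= n <= d' /\ d' <= d)%R ->
  rect_int g a' b' c' d' = rect_int g a' m c' n + rect_int g m b' c' n +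
    (rect_int g a' m n d' + rect_int g m b' n d').
Proof.
  intros Hg H1 H2. unfold rect_int.
  rewrite (CInt_Chasles (fun x => g (x, c')) a' m b')
    by (apply (ex_CInt_horizontal g a b c d); trivial; lra).
  rewrite (CInt_Chasles (fun x => g (x, d')) a' m b')
    by (apply (ex_CInt_horizontal g a b c d); trivial; lra).
  rewrite (CInt_Chasles (fun y => g (a', y)) c' n d')
    by (apply (ex_CInt_vertical g a b c d); trivial; lra).
  rewrite (CInt_Chasles (fun y => g (b', y)) c' n d')
    by (apply (ex_CInt_vertical g a b c d); trivial; lra).
  ring.
Qed.

(* Only the error of the affine approximation contributes, since opposite sides
   of the rectangle cancel on affine functions. *)
Lemma rect_int_small (g : C -> C) (a b c d a' b' c' d' e : R) (z0 g0 l : C) :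
  cdiff_rect g a b c d ->
  (a <= a' /\ a' <= fst z0 <= b' /\ b' <= b)%R -> (c <= c' /\ c' <= snd z0 <= d' /\ d' <= d)%R ->
  (0 <= e)%R ->
  (forall x y, (a' <= x <= b')%R -> (c' <= y <= d')%R ->
    (Cmod (g (x, y) - g0 - l * ((x, y) - z0)) <= e * Cmod ((x, y) - z0))%R) ->
  (Cmod (rect_int g a' b' c' d') <= 2 * e * ((b' - a') + (d' - c')) ^ 2)%R.
Proof.
  intros Hg H1 H2 He Happ.
  assert (Err : forall x y, (a' <= x <= b')%R -> (c' <= y <= d')%R ->
    (Cmod (g (x, y) - g0 - l * ((x, y) - z0)) <= e * ((b' - a') + (d' - c')))%R).
  { intros x y Hx Hy. eapply Rle_trans; [apply Happ; assumption |].
    apply Rmult_le_compat_l; [exact He |].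
    eapply Rle_trans; [apply Cmod_le_components |]. destruct z0 as [x0 y0]; simpl in *.
    apply Rplus_le_compat; apply Rabs_le; lra. }
  assert (Ex1 : ex_CInt (fun x => g (x, c')) a' b') by (apply (ex_CInt_horizontal g a b c d); trivial; lra).
  assert (Ex2 : ex_CInt (fun x => g (x, d')) a' b') by (apply (ex_CInt_horizontal g a b c d); trivial; lra).
  assert (Ex3 : ex_CInt (fun y => g (b', y)) c' d') by (apply (ex_CInt_vertical g a b c d); trivial; lra).
  assert (Ex4 : ex_CInt (fun y => g (a', y)) c' d') by (apply (ex_CInt_vertical g a b c d); trivial; lra).
  (* [k1] and [k2] are the differences of the affine part across the two pairs of opposite sides.
     They are constant along the sides, and (b' - a') k1 + Ci (d' - c') k2 = 0, so subtracting them
     leaves the contour integral unchanged. *)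
  set (k1 := l * (RtoC c' - RtoC d') * Ci). set (k2 := l * (RtoC b' - RtoC a')).
  set (f1 := fun x : R => g (x, c') - g (x, d') - k1).
  set (f2 := fun y : R => g (b', y) - g (a', y) - k2).
  assert (Exf1 : ex_CInt f1 a' b').
  { apply (ex_RInt_minus (V := C_R_CompleteNormedModule));
      [apply (ex_RInt_minus (V := C_R_CompleteNormedModule)); assumption |].
    apply (ex_RInt_const (V := C_R_CompleteNormedModule)). }
  assert (Exf2 : ex_CInt f2 c' d').
  { apply (ex_RInt_minus (V := C_R_CompleteNormedModule));
      [apply (ex_RInt_minus (V := C_R_CompleteNormedModule)); assumption |].
    apply (ex_RInt_const (V := C_R_CompleteNormedModule)). }
  assert (E : rect_int g a' b' c' d' = CInt f1 a' b' + Ci * CInt f2 c' d').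
  { unfold f1, f2, rect_int.
    rewrite (CInt_minus (fun x => g (x, c') - g (x, d'))), CInt_minus, CInt_const; trivial;
      [| now apply (ex_RInt_minus (V := C_R_CompleteNormedModule))
       | apply (ex_RInt_const (V := C_R_CompleteNormedModule))].
    rewrite (CInt_minus (fun y => g (b', y) - g (a', y))), CInt_minus, CInt_const; trivial;
      [| now apply (ex_RInt_minus (V := C_R_CompleteNormedModule))
       | apply (ex_RInt_const (V := C_R_CompleteNormedModule))].
    unfold k1, k2. rewrite !RtoC_minus. ring. }
  rewrite E. eapply Rle_trans; [apply Cmod_triangle |].
  rewrite Cmod_mult, Cmod_Ci, Rmult_1_l.
  assert (B1 : (Cmod (CInt f1 a' b') <= (b' - a') * (2 * e * ((b' - a') + (d' - c'))))%R).
  { apply CInt_norm_le; trivial; [lra |]. intros x Hx. unfold f1.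
    replace (g (x, c') - g (x, d') - k1) with
      ((g (x, c') - g0 - l * ((x, c') - z0)) + - (g (x, d') - g0 - l * ((x, d') - z0))).
    - eapply Rle_trans; [apply Cmod_triangle |]. rewrite Cmod_opp.
      pose proof (Err x c' Hx ltac:(lra)). pose proof (Err x d' Hx ltac:(lra)). lra.
    - assert (Ek : k1 = l * ((x, c') - (x, d'))).
      { unfold k1. rewrite <- Cmult_assoc. f_equal.
        unfold RtoC, Ci, Cminus, Cplus, Copp, Cmult; simpl. f_equal; ring. }
      rewrite Ek. ring. }
  assert (B2 : (Cmod (CInt f2 c' d') <= (d' - c') * (2 * e * ((b' - a') + (d' - c'))))%R).
  { apply CInt_norm_le; trivial; [lra |]. intros y Hy. unfold f2.
    replace (g (b', y) - g (a', y) - k2) with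
      ((g (b', y) - g0 - l * ((b', y) - z0)) + - (g (a', y) - g0 - l * ((a', y) - z0))).
    - eapply Rle_trans; [apply Cmod_triangle |]. rewrite Cmod_opp.
      pose proof (Err b' y ltac:(lra) Hy). pose proof (Err a' y ltac:(lra) Hy). lra.
    - assert (Ek : k2 = l * ((b', y) - (a', y))).
      { unfold k2. f_equal. unfold RtoC, Cminus, Cplus, Copp; simpl. f_equal; ring. }
      rewrite Ek. ring. }
  nra.
Qed.

Lemma goursat (g : C -> C) (a b c d : R) :
  cdiff_rect g a b c d -> (a <= b)%R -> (c <= d)%R -> rect_int g a b c d = 0.
Proof.
  intros Hg Hab Hcd. apply Cmod_eq_0, Rle_antisym; [| apply Cmod_ge_0].
  apply le_epsilon; intros e He. rewrite Rplus_0_l.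
  set (k := (e / (2 * (((b - a) + (d - c)) ^ 2 + 1)))%R).
  set (S := ((b - a) + (d - c))%R) in *.
  assert (HS : (0 <= S ^ 2)%R) by (apply pow2_ge_0).
  assert (Hk : (0 < k)%R).
  { apply Rdiv_lt_0_compat; lra. }
  apply Rle_trans with (2 * k * S ^ 2)%R.
  2: { unfold k. apply Rle_trans with (e * (S ^ 2 / (S ^ 2 + 1)))%R.
       - right; field; lra.
       - rewrite <- (Rmult_1_r e) at 2. apply Rmult_le_compat_l; [lra |].
         apply Rle_div_l; lra. }
  (* The bound is quadratic in the half-perimeter: four quarters, each with half of it, add up
     exactly to the bound for the whole rectangle. *)
  apply (rect_bisection (fun a' b' c' d' =>
    (Cmod (rect_int g a' b' c' d') <= 2 * k * ((b' - a') + (d' - c')) ^ 2)%R)); trivial.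
  - intros a' b' c' d' H1 H2 m n Q1 Q2 Q3 Q4.
    rewrite (rect_int_split g a b c d a' b' c' d' m n) by (trivial; unfold m, n; lra).
    apply Rle_trans with
      (2 * k * (m - a' + (n - c')) ^ 2 + 2 * k * (b' - m + (n - c')) ^ 2 +
       (2 * k * (m - a' + (d' - n)) ^ 2 + 2 * k * (b' - m + (d' - n)) ^ 2))%R.
    { pose proof (Cmod_triangle (rect_int g a' m c' n) (rect_int g m b' c' n)).
      pose proof (Cmod_triangle (rect_int g a' m n d') (rect_int g m b' n d')).
      eapply Rle_trans; [apply Cmod_triangle |]. lra. }
    right. unfold m, n. field.
  - intros x y Hx Hy.
    destruct (Hg x y Hx Hy) as (l & phi & Hc & El & Hphi).
    apply continuous_to_C_eps with (e := k) in Hc; [| exact Hk].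
    apply locally_C_Cmod in Hc. destruct Hc as (del & Hdel & Hc).
    exists (del / 2)%R. split; [lra |].
    intros a' b' c' d' H1 H2 H3 H4.
    apply (rect_int_small g a b c d a' b' c' d' k (x, y) (g (x, y)) l); simpl; trivial; try lra.
    intros x' y' Hx' Hy'. rewrite (Hphi (x', y')).
    replace (g (x, y) + phi (x', y') * ((x', y') - (x, y)) - g (x, y) - l * ((x', y') - (x, y)))
      with ((phi (x', y') - l) * ((x', y') - (x, y))) by ring.
    rewrite Cmod_mult. apply Rmult_le_compat_r; [apply Cmod_ge_0 |].
    rewrite <- El. left. apply Hc.
    eapply Rle_lt_trans; [apply Cmod_le_components |]. simpl.
    assert (Rabs (x' + - x) < del / 2)%R by (apply Rabs_def1; lra).
    assert (Rabs (y' + - y) < del / 2)%R by (apply Rabs_def1; lra).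
    lra.
Qed.

(** * Taylor coefficients *)

Lemma cderiv_of_eps (f : C -> C) (z d : C) :
  (forall e, (0 < e)%R -> exists del, (0 < del)%R /\ forall w, (Cmod (w - z) < del)%R ->
    (Cmod (f w - f z - d * (w - z)) <= e * Cmod (w - z))%R) -> cderiv f z d.
Proof.
  intro H.
  exists (fun w => if Ceq_dec w z then d else (f w - f z) / (w - z)).
  split; [| split].
  - apply continuous_to_C_eps. intros e He.
    destruct (H (e / 2)%R) as (del & Hdel & Hd); [lra |].
    apply locally_C_Cmod. exists del. split; [exact Hdel |]. intros w Hw.
    destruct (Ceq_dec z z) as [_ |]; [| easy].
    destruct (Ceq_dec w z) as [_ | Hn].
    + replace (d - d) with (RtoC 0) by ring. rewrite Cmod_0. exact He.
    + specialize (Hd w Hw). apply Cminus_eq_contra in Hn.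
      replace ((f w - f z) / (w - z) - d) with ((f w - f z - d * (w - z)) / (w - z))
        by now field.
      rewrite Cmod_div by exact Hn. apply Cmod_gt_0 in Hn.
      apply Rle_lt_trans with (e / 2)%R; [| lra].
      apply Rle_div_l; lra.
  - destruct (Ceq_dec z z); easy.
  - intro w. destruct (Ceq_dec w z) as [-> | Hn]; [ring |].
    apply Cminus_eq_contra in Hn. now field.
Qed.

(** * The complex exponential and circles around 0 *)

Definition cexp (z : C) : C := (exp (fst z) * cos (snd z), exp (fst z) * sin (snd z))%R.

Lemma cexp_plus (z w : C) : cexp (z + w) = cexp z * cexp w.
Proof.
  unfold cexp, Cplus, Cmult; simpl. rewrite exp_plus, cos_plus, sin_plus.
  f_equal; ring.
Qed.

Lemma Cmod_cexp (z : C) : Cmod (cexp z) = exp (fst z).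
Proof.
  unfold cexp, Cmod. cbn [fst snd].
  replace ((exp (fst z) * cos (snd z)) ^ 2 + (exp (fst z) * sin (snd z)) ^ 2)%R
    with (exp (fst z) ^ 2)%R.
  - apply sqrt_pow2. left. apply exp_pos.
  - pose proof (sin2_cos2 (snd z)) as H. unfold Rsqr in H.
    transitivity (exp (fst z) ^ 2 * (sin (snd z) * sin (snd z) + cos (snd z) * cos (snd z)))%R.
    + rewrite H; ring.
    + ring.
Qed.

Lemma cexp_neq_0 (z : C) : cexp z <> 0.
Proof. apply Cmod_gt_0. rewrite Cmod_cexp. apply exp_pos. Qed.

Lemma derivable_pt_lim_linear (f : R -> R) (x l : R) :
  derivable_pt_lim f x l -> forall e, (0 < e)%R -> exists del, (0 < del)%R /\
    forall h, (Rabs h < del)%R -> (Rabs (f (x + h) - f x - l * h) <= e * Rabs h)%R.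
Proof.
  intros H e He. destruct (H e He) as [del Hd].
  exists del. split; [apply cond_pos |]. intros h Hh.
  destruct (Req_dec h 0) as [-> | Hn].
  - rewrite Rplus_0_r. replace (f x - f x - l * 0)%R with 0%R by ring. rewrite Rabs_R0. lra.
  - specialize (Hd h Hn Hh).
    replace (f (x + h) - f x - l * h)%R with (((f (x + h) - f x) / h - l) * h)%R by now field.
    rewrite Rabs_mult. apply Rmult_le_compat_r; [apply Rabs_pos | lra].
Qed.

Lemma cderiv_cexp_0 : cderiv cexp 0 1.
Proof.
  apply cderiv_of_eps. intros e He.
  (* The errors [F1] to [F4] below have bounds 2, 2, 1 and 1 times k * m, hence the 6. The bound k
     <= 1 yields exp x <= 2 when |x| < k / 2. *)
  set (k := Rmin (e / 6) 1).
  assert (Hk : (0 < k)%R) by (apply Rmin_glb_lt; lra).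
  assert (Hk1 : (k <= e / 6)%R) by apply Rmin_l. assert (Hk2 : (k <= 1)%R) by apply Rmin_r.
  destruct (derivable_pt_lim_linear exp 0 1) with (e := k) as (d1 & Hd1 & H1); trivial.
  { pose proof (derivable_pt_lim_exp 0) as D. now rewrite exp_0 in D. }
  destruct (derivable_pt_lim_linear sin 0 1) with (e := k) as (d2 & Hd2 & H2); trivial.
  { pose proof (derivable_pt_lim_sin 0) as D. now rewrite cos_0 in D. }
  destruct (derivable_pt_lim_linear cos 0 0) with (e := k) as (d3 & Hd3 & H3); trivial.
  { pose proof (derivable_pt_lim_cos 0) as D. now rewrite sin_0, Ropp_0 in D. }
  exists (Rmin (Rmin d1 d2) (Rmin d3 (k / 2))). split.
  { repeat apply Rmin_glb_lt; lra. }
  intros [x y] Hw.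
  assert (Ew : Cminus (x, y) 0 = (x, y)).
  { unfold Cminus, Cplus, Copp, RtoC; simpl. f_equal; ring. }
  rewrite Ew in *.
  assert (Hx : (Rabs x <= Cmod (x, y))%R) by apply (Rabs_fst_le_Cmod (x, y)).
  assert (Hy : (Rabs y <= Cmod (x, y))%R) by apply (Rabs_snd_le_Cmod (x, y)).
  set (m := Cmod (x, y)) in *.
  assert (Hm1 : (m < d1)%R).
  { eapply Rlt_le_trans; [exact Hw |]. eapply Rle_trans; [apply Rmin_l | apply Rmin_l]. }
  assert (Hm2 : (m < d2)%R).
  { eapply Rlt_le_trans; [exact Hw |]. eapply Rle_trans; [apply Rmin_l | apply Rmin_r]. }
  assert (Hm3 : (m < d3)%R).
  { eapply Rlt_le_trans; [exact Hw |]. eapply Rle_trans; [apply Rmin_r | apply Rmin_l]. }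
  assert (Hm4 : (m < k / 2)%R).
  { eapply Rlt_le_trans; [exact Hw |]. eapply Rle_trans; [apply Rmin_r | apply Rmin_r]. }
  specialize (H1 x ltac:(lra)). specialize (H2 y ltac:(lra)). specialize (H3 y ltac:(lra)).
  rewrite Rplus_0_l in H1, H2, H3. rewrite exp_0 in H1. rewrite sin_0 in H2. rewrite cos_0 in H3.
  assert (E1 : (Rabs (exp x - 1) <= k)%R).
  { replace (exp x - 1)%R with ((exp x - 1 - 1 * x) + x)%R by ring.
    eapply Rle_trans; [apply Rabs_triang |]. pose proof (Rabs_pos x). nra. }
  assert (E2 : (Rabs (exp x) <= 2)%R).
  { rewrite Rabs_pos_eq by (left; apply exp_pos). apply Rabs_le_between in E1. lra. }
  assert (Hm0 : (0 <= m)%R) by apply Cmod_ge_0.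
  eapply Rle_trans; [apply Cmod_le_components |].
  unfold cexp, RtoC, Cminus, Cplus, Copp, Cmult; cbn [fst snd].
  rewrite exp_0, cos_0, sin_0.
  replace (exp x * cos y + - (1 * 1) + - (1 * x - 0 * y))%R with
    ((exp x - 1 - 1 * x) + exp x * (cos y - 1 - 0 * y))%R by ring.
  replace (exp x * sin y + - (1 * 0) + - (1 * y + 0 * x))%R with
    (exp x * (sin y - 0 - 1 * y) + (exp x - 1) * y)%R by ring.
  assert (F1 : (Rabs (exp x * (cos y - 1 - 0 * y)) <= 2 * (k * m))%R).
  { rewrite Rabs_mult. apply Rmult_le_compat; try apply Rabs_pos; trivial.
    eapply Rle_trans; [exact H3 |]. apply Rmult_le_compat_l; lra. }
  assert (F2 : (Rabs (exp x * (sin y - 0 - 1 * y)) <= 2 * (k * m))%R).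
  { rewrite Rabs_mult. apply Rmult_le_compat; try apply Rabs_pos; trivial.
    eapply Rle_trans; [exact H2 |]. apply Rmult_le_compat_l; lra. }
  assert (F3 : (Rabs ((exp x - 1) * y) <= k * m)%R).
  { rewrite Rabs_mult. apply Rmult_le_compat; try apply Rabs_pos; trivial. }
  assert (F4 : (Rabs (exp x - 1 - 1 * x) <= k * m)%R).
  { eapply Rle_trans; [exact H1 |]. apply Rmult_le_compat_l; lra. }
  eapply Rle_trans; [apply Rplus_le_compat; apply Rabs_triang |].
  apply Rle_trans with (6 * k * m)%R; [lra |].
  apply Rmult_le_compat_r; lra.
Qed.

(** The functional equation transports the derivative from 0 to [z]. *)
Lemma cdiff_cexp (z : C) : cdiff cexp z.
Proof.
  destruct cderiv_cexp_0 as (phi & Hc & E & H).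
  exists (cexp z), (fun w => cexp z * phi (w - z)). split; [| split].
  - apply continuous_Cmult; [apply continuous_const |].
    apply (continuous_comp (U := C_UniformSpace) (V := C_UniformSpace) (W := C_UniformSpace)
      (fun w => w + - z) phi).
    + apply continuous_Cplus; [apply continuous_id | apply continuous_const].
    + now replace (z + - z) with (RtoC 0) by ring.
  - replace (z - z) with (RtoC 0) by ring. rewrite E; ring.
  - intro w. replace w with (z + (w - z)) at 1 by ring.
    rewrite cexp_plus, (H (w - z)).
    replace (cexp 0) with (RtoC 1); [ring |].
    unfold cexp, RtoC; simpl. rewrite exp_0, cos_0, sin_0. f_equal; ring.
Qed.

Definition circle (r t : R) : C := (r * cos t, r * sin t)%R.

Lemma cexp_ln (r t : R) : (0 < r)%R -> cexp (ln r, t) = circle r t.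
Proof. intro Hr. unfold cexp, circle; simpl. now rewrite exp_ln. Qed.

Lemma Cmod_circle (r t : R) : (0 < r)%R -> Cmod (circle r t) = r.
Proof. intro Hr. rewrite <- cexp_ln, Cmod_cexp by exact Hr. now apply exp_ln. Qed.

Lemma circle_neq_0 (r t : R) : (0 < r)%R -> circle r t <> 0.
Proof. intro Hr. apply Cmod_gt_0. now rewrite Cmod_circle. Qed.

Lemma continuous_circle (r t : R) :
  continuous (T := R_UniformSpace) (U := C_UniformSpace) (circle r) t.
Proof.
  apply continuous_C_components; simpl;
    apply (continuous_mult (K := R_AbsRing)); try apply continuous_const.
  - apply continuous_cos.
  - apply continuous_sin.
Qed.

(* The n-th Taylor coefficient at 0, read off from the circle of radius [r]. *)
Definition coef (f : C -> C) (n : nat) (r : R) : C :=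
  RtoC (/ (2 * PI)) * CInt (fun t => f (circle r t) / circle r t ^ n) 0 (2 * PI).

Definition cdiff_disk (f : C -> C) (R0 : R) : Prop := forall z, (Cmod z < R0)%R -> cdiff f z.

Lemma continuous_coef_integrand (f : C -> C) (n : nat) (r t : R) :
  (0 < r)%R -> cdiff f (circle r t) ->
  continuous (T := R_UniformSpace) (U := C_UniformSpace)
    (fun t => f (circle r t) / circle r t ^ n) t.
Proof.
  intros Hr Hf.
  apply (continuous_comp (V := C_UniformSpace) (circle r) (fun z => f z / z ^ n)).
  - apply continuous_circle.
  - apply cdiff_continuous. apply cdiff_mult; trivial.
    apply (cdiff_comp Cinv (fun w => w ^ n)).
    + apply cdiff_Cinv, Cpow_nz, circle_neq_0, Hr.
    + apply cdiff_pow, cdiff_id.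
Qed.

Lemma ex_CInt_coef (f : C -> C) (n : nat) (r R0 : R) :
  (0 < r < R0)%R -> cdiff_disk f R0 ->
  ex_CInt (fun t => f (circle r t) / circle r t ^ n) 0 (2 * PI).
Proof.
  intros Hr Hf. apply CInt_continuous.
  - pose proof PI_RGT_0; lra.
  - intros t _. apply continuous_coef_integrand; [lra |].
    apply Hf. rewrite Cmod_circle; lra.
Qed.

(* Goursat's theorem for [f (cexp z) / cexp z ^ n] on [ln r1, ln r2] x [0, 2 PI]:
   the horizontal sides cancel by periodicity. *)
Lemma coef_radius (f : C -> C) (n : nat) (r1 r2 R0 : R) :
  (0 < r1 <= r2)%R -> (r2 < R0)%R -> cdiff_disk f R0 -> coef f n r1 = coef f n r2.
Proof.
  intros Hr1 Hr2 Hf. unfold coef. f_equal.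
  set (g := fun z => f (cexp z) / cexp z ^ n).
  pose proof (goursat g (ln r1) (ln r2) 0 (2 * PI)) as G.
  assert (Hp : forall x, g (x, 0%R) = g (x, (2 * PI)%R)).
  { intro x. unfold g, cexp; simpl. rewrite cos_0, sin_0, cos_2PI, sin_2PI. reflexivity. }
  assert (Hc : forall r, (0 < r)%R -> CInt (fun t => g (ln r, t)) 0 (2 * PI) =
    CInt (fun t => f (circle r t) / circle r t ^ n) 0 (2 * PI)).
  { intros r Hr. apply (RInt_ext (V := C_R_CompleteNormedModule)). intros t _.
    unfold g. now rewrite cexp_ln. }
  rewrite <- (Hc r1), <- (Hc r2) by lra.
  unfold rect_int in G.
  rewrite (RInt_ext (V := C_R_CompleteNormedModule) _ _ _ _ (fun x _ => Hp x)) in G.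
  assert (E : RtoC 0 = Ci * (CInt (fun y => g (ln r2, y)) 0 (2 * PI) -
                        CInt (fun y => g (ln r1, y)) 0 (2 * PI))).
  { rewrite <- G.
    - ring.
    - intros x y Hx _. unfold g. apply cdiff_mult.
      + apply (cdiff_comp f cexp).
        * apply Hf. rewrite Cmod_cexp. simpl. eapply Rle_lt_trans; [| exact Hr2].
          rewrite <- (exp_ln r2) by lra.
          destruct (Rle_lt_or_eq_dec x (ln r2)) as [H | ->]; [lra | | right; reflexivity].
          left; now apply exp_increasing.
        * apply cdiff_cexp.
      + apply (cdiff_comp Cinv (fun z => cexp z ^ n)).
        * apply cdiff_Cinv, Cpow_nz, cexp_neq_0.
        * apply cdiff_pow, cdiff_cexp.
    - destruct (Rle_lt_or_eq_dec r1 r2) as [H | ->]; [lra | | right; reflexivity].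
      left; apply ln_increasing; lra.
    - pose proof PI_RGT_0; lra. }
  assert (Inj : forall u v : C, RtoC 0 = Ci * (u - v) -> v = u).
  { intros u v Huv.
    replace v with (u - (- Ci * (Ci * (u - v)))).
    - rewrite <- Huv. ring.
    - assert (Hi : Ci * Ci = - RtoC 1)
        by (unfold Ci, Cmult, RtoC, Copp; simpl; f_equal; ring).
      replace (- Ci * (Ci * (u - v))) with (- (Ci * Ci) * (u - v)) by ring.
      rewrite Hi. ring. }
  apply Inj, E.
Qed.

Lemma coef_norm_le (f : C -> C) (n : nat) (r R0 M : R) :
  (0 < r < R0)%R -> cdiff_disk f R0 ->
  (forall z, Cmod z = r -> (Cmod (f z) <= M)%R) -> (Cmod (coef f n r) <= M / r ^ n)%R.
Proof.
  intros Hr Hf HM. unfold coef. pose proof PI_RGT_0 as Hpi.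
  assert (Hi : (0 < / (2 * PI))%R) by (apply Rinv_0_lt_compat; lra).
  rewrite Cmod_mult, Cmod_R, Rabs_pos_eq by lra.
  apply Rle_trans with (/ (2 * PI) * ((2 * PI - 0) * (M / r ^ n)))%R.
  - apply Rmult_le_compat_l; [lra |].
    apply CInt_norm_le; [lra | | now apply ex_CInt_coef with R0].
    intros t _. assert (Hn : circle r t <> 0) by (apply circle_neq_0; lra).
    rewrite Cmod_div by (now apply Cpow_nz). rewrite Cmod_pow, Cmod_circle by lra.
    apply Rmult_le_compat_r.
    + left. apply Rinv_0_lt_compat, pow_lt; lra.
    + apply HM. apply Cmod_circle; lra.
  - right. field. split; [apply pow_nonzero; lra | lra].
Qed.

Lemma coef_lin (f g : C -> C) (c : C) (n : nat) (r R0 : R) :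
  (0 < r < R0)%R -> cdiff_disk f R0 -> cdiff_disk g R0 ->
  coef (fun z => f z + c * g z) n r = coef f n r + c * coef g n r.
Proof.
  intros Hr Hf Hg. unfold coef.
  pose proof (ex_CInt_coef f n r R0 Hr Hf) as E1.
  pose proof (ex_CInt_coef g n r R0 Hr Hg) as E2.
  rewrite (RInt_ext (V := C_R_CompleteNormedModule) _
    (fun t => f (circle r t) / circle r t ^ n + c * (g (circle r t) / circle r t ^ n))).
  - rewrite CInt_plus; trivial; [| now apply ex_CInt_mult].
    rewrite CInt_mult by trivial. ring.
  - intros t _. assert (circle r t <> 0) by (apply circle_neq_0; lra).
    change ((f (circle r t) + c * g (circle r t)) / circle r t ^ n =
      f (circle r t) / circle r t ^ n + c * (g (circle r t) / circle r t ^ n)).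
    unfold Cdiv. ring.
Qed.

Lemma coef_ext (f g : C -> C) (n : nat) (r : R) :
  (0 < r)%R -> (forall z, Cmod z = r -> f z = g z) -> coef f n r = coef g n r.
Proof.
  intros Hr H. unfold coef. f_equal. apply (RInt_ext (V := C_R_CompleteNormedModule)).
  intros t _. rewrite H; [reflexivity |]. now apply Cmod_circle.
Qed.

Lemma coef_shift (f : C -> C) (m n : nat) (r : R) :
  (0 < r)%R -> coef (fun z => z ^ m * f z) (m + n) r = coef f n r.
Proof.
  intro Hr. unfold coef. f_equal. apply (RInt_ext (V := C_R_CompleteNormedModule)).
  intros t _. assert (Hc : circle r t <> 0) by (now apply circle_neq_0).
  rewrite Cpow_add_r.
  pose proof (Cpow_nz _ m Hc). pose proof (Cpow_nz _ n Hc).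
  change (circle r t ^ m * f (circle r t) / (circle r t ^ m * circle r t ^ n) =
    f (circle r t) / circle r t ^ n). now field.
Qed.

Lemma coef_1_0 (r : R) : (0 < r)%R -> coef (fun _ => 1) 0 r = 1.
Proof.
  intro Hr. unfold coef.
  rewrite (RInt_ext (V := C_R_CompleteNormedModule) _ (fun _ => RtoC 1)).
  - rewrite CInt_const, Cmult_1_r, <- RtoC_mult. f_equal. field. apply PI_neq0.
  - intros t _. change (1 / 1 = RtoC 1). field.
Qed.

(** No trigonometric integral is computed: the constant function is entire, so the radius may grow
    to some s >= 1 / e with s >= 1, where the Cauchy bound 1 / s^(n+1) is at most e. *)
Lemma coef_1_S (n : nat) (r : R) : (0 < r)%R -> coef (fun _ => 1) (S n) r = 0.
Proof.
  intro Hr. apply Cmod_eq_0, Rle_antisym; [| apply Cmod_ge_0].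
  apply le_epsilon; intros e He. rewrite Rplus_0_l.
  set (s := Rmax r (Rmax 1 (/ e))).
  assert (H1 : (r <= s)%R) by apply Rmax_l.
  assert (H2 : (1 <= s)%R) by (eapply Rle_trans; [apply Rmax_l | apply Rmax_r]).
  assert (H3 : (/ e <= s)%R) by (eapply Rle_trans; [apply Rmax_r | apply Rmax_r]).
  assert (D : cdiff_disk (fun _ => 1) (s + 1)) by (intros z _; apply cdiff_const).
  rewrite (coef_radius _ _ r s (s + 1)) by (trivial; lra).
  eapply Rle_trans; [apply (coef_norm_le _ _ s (s + 1) 1) |]; trivial; try lra.
  - intros z _. rewrite Cmod_1. lra.
  - assert (s <= s ^ S n)%R.
    { simpl. rewrite <- (Rmult_1_r s) at 1. apply Rmult_le_compat_l; [lra |].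
      now apply pow_R1_Rle. }
    apply Rle_div_l; [lra |].
    apply Rle_trans with (e * s)%R.
    + apply Rmult_le_reg_l with (/ e)%R; [now apply Rinv_0_lt_compat |].
      rewrite <- Rmult_assoc, Rinv_l, Rmult_1_l, Rmult_1_r by lra. exact H3.
    + apply Rmult_le_compat_l; lra.
Qed.

Lemma coef_pow_eq (n : nat) (r : R) : (0 < r)%R -> coef (fun z => z ^ n) n r = 1.
Proof.
  intro Hr. rewrite (coef_ext _ (fun z => z ^ n * 1) n r Hr) by (intros; ring).
  pose proof (coef_shift (fun _ => 1) n 0 r Hr) as Hs. rewrite Nat.add_0_r in Hs.
  rewrite Hs. now apply coef_1_0.
Qed.

Lemma coef_pow_lt (m n : nat) (r : R) :
  (m < n)%nat -> (0 < r)%R -> coef (fun z => z ^ m) n r = 0.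
Proof.
  intros Hmn Hr. rewrite (coef_ext _ (fun z => z ^ m * 1) n r Hr) by (intros; ring).
  replace n with (m + S (n - m - 1))%nat by lia.
  rewrite coef_shift by exact Hr. now apply coef_1_S.
Qed.

(** On a small circle of radius s, [f] differs from its affine part by at most e s, so the first
    coefficient of the difference is at most e; and the radius may be shrunk freely. *)
Lemma coef_deriv (f : C -> C) (d : C) (r R0 : R) :
  (0 < r < R0)%R -> cdiff_disk f R0 -> cderiv f 0 d -> coef f 1 r = d.
Proof.
  intros Hr Hf (phi & Hc & E & H).
  apply Ceq_minus, Cmod_eq_0, Rle_antisym; [| apply Cmod_ge_0].
  apply le_epsilon; intros e He. rewrite Rplus_0_l.
  apply continuous_to_C_eps with (e := e) in Hc; [| exact He].
  apply locally_C_Cmod in Hc. destruct Hc as (del & Hdel & Hc).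
  set (s := Rmin r (del / 2)).
  assert (Hs : (0 < s)%R) by (apply Rmin_glb_lt; lra).
  assert (Hs1 : (s <= r)%R) by apply Rmin_l.
  assert (Hs2 : (s <= del / 2)%R) by apply Rmin_r.
  rewrite <- (coef_radius f 1 s r R0) by (trivial; lra).
  assert (L : forall c, cdiff_disk (fun z => c * z ^ 0) R0).
  { intros c z _. apply cdiff_mult; [apply cdiff_const | apply cdiff_pow, cdiff_id]. }
  assert (L1 : cdiff_disk (fun z => z ^ 1) R0).
  { intros z _. apply cdiff_pow, cdiff_id. }
  (* The affine part is written with [z ^ 0] and [z ^ 1] so that its coefficients are those of
     powers. *)
  assert (Ed : coef f 1 s - d =
    coef (fun z => (f z + - f 0 * z ^ 0) + - d * z ^ 1) 1 s).
  { rewrite (coef_lin (fun z => f z + - f 0 * z ^ 0) (fun z => z ^ 1) _ _ s R0);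
      trivial; [| lra |].
    - rewrite (coef_lin f (fun z => z ^ 0) _ _ s R0); trivial; [| lra |].
      + rewrite coef_pow_eq, coef_pow_lt by (trivial; lia). ring.
      + intros z _. apply cdiff_pow, cdiff_id.
    - intros z Hz. apply cdiff_plus; [now apply Hf | now apply (L (- f 0))]. }
  rewrite Ed.
  eapply Rle_trans; [apply (coef_norm_le _ _ s R0 (e * s)); [lra | |] |].
  - intros z Hz. apply cdiff_plus.
    + apply cdiff_plus; [now apply Hf | now apply L].
    + apply cdiff_mult; [apply cdiff_const | now apply L1].
  - intros z Hz. rewrite (H z).
    replace (f 0 + phi z * (z - 0) + - f 0 * z ^ 0 + - d * z ^ 1) with ((phi z - phi 0) * z)
      by (rewrite E; simpl; ring).
    rewrite Cmod_mult, Hz. apply Rmult_le_compat_r; [lra |].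
    left. apply Hc. replace (z - 0) with z by ring. lra.
  - simpl. right; field. lra.
Qed.

(** * Cauchy estimates *)

Lemma cderiv_translate (f : C -> C) (z0 z d : C) :
  cderiv f (z0 + z) d -> cderiv (fun w => f (z0 + w)) z d.
Proof.
  intros (phi & Hc & E & H).
  exists (fun w => phi (z0 + w)). split; [| split].
  - apply (continuous_comp (U := C_UniformSpace) (V := C_UniformSpace) (W := C_UniformSpace)
      (fun w => z0 + w) phi); trivial.
    apply continuous_Cplus; [apply continuous_const | apply continuous_id].
  - exact E.
  - intro w. rewrite (H (z0 + w)). ring.
Qed.

Lemma cauchy_deriv_bound (f : C -> C) (z0 d : C) (r rho M : R) :
  (0 < r < rho)%R -> (forall z, (Cmod (z - z0) < rho)%R -> cdiff f z /\ (Cmod (f z) <= M)%R) ->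
  cderiv f z0 d -> (Cmod d <= M / r)%R.
Proof.
  intros Hr Hf Hd.
  assert (Hg : cdiff_disk (fun w => f (z0 + w)) rho).
  { intros z Hz. destruct (Hf (z0 + z)) as [[d' H] _].
    - now replace (z0 + z - z0) with z by ring.
    - exists d'. now apply cderiv_translate. }
  rewrite <- (coef_deriv _ d r rho Hr Hg).
  - replace (M / r)%R with (M / r ^ 1)%R by (simpl; field; lra).
    apply coef_norm_le with rho; trivial.
    intros z Hz. apply Hf. replace (z0 + z - z0) with z by ring. lra.
  - apply cderiv_translate. now replace (z0 + 0) with z0 by ring.
Qed.

Lemma is_derive_Re_path (f : C -> C) (u w v d : C) (t : R) :
  Cmod u = 1%R -> cderiv f (w + RtoC t * v) d ->
  is_derive (fun s : R => Re (u * f (w + RtoC s * v))) t (Re (u * d * v)).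
Proof.
  intros Hu (phi & Hc & E & H).
  apply is_derive_Reals. intros e He.
  assert (Hv : (0 < Cmod v + 1)%R) by (pose proof (Cmod_ge_0 v); lra).
  apply continuous_to_C_eps with (e := (e / (Cmod v + 1))%R) in Hc;
    [| now apply Rdiv_lt_0_compat].
  apply locally_C_Cmod in Hc. destruct Hc as (del & Hdel & Hc).
  assert (Hdv : (0 < del / (Cmod v + 1))%R) by now apply Rdiv_lt_0_compat.
  exists (mkposreal _ Hdv). cbn [pos]. intros h Hh0 Hh.
  assert (E1 : w + RtoC (t + h) * v - (w + RtoC t * v) = RtoC h * v)
    by (rewrite RtoC_plus; ring).
  rewrite (H (w + RtoC (t + h) * v)), E1.
  set (p := phi (w + RtoC (t + h) * v)).
  replace ((Re (u * (f (w + RtoC t * v) + p * (RtoC h * v)))%C -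
    Re (u * f (w + RtoC t * v))%C) / h - Re (u * d * v)%C)%R with (Re (u * (p - d) * v)).
  2: { replace (u * (f (w + RtoC t * v) + p * (RtoC h * v))) with
         (u * f (w + RtoC t * v) + RtoC h * (u * p * v)) by ring.
       replace (u * (p - d) * v) with (u * p * v - u * d * v) by ring.
       unfold Cminus. rewrite !re_plus, re_opp, re_scal_l. now field. }
  eapply Rle_lt_trans; [apply re_le_Cmod |].
  rewrite !Cmod_mult, Hu, Rmult_1_l.
  apply Rle_lt_trans with (Cmod (p - d) * (Cmod v + 1))%R.
  { apply Rmult_le_compat_l; [apply Cmod_ge_0 | lra]. }
  apply Rlt_le_trans with (e / (Cmod v + 1) * (Cmod v + 1))%R; [| right; field; lra].
  apply Rmult_lt_compat_r; [exact Hv |].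
  rewrite <- E. apply Hc. rewrite E1, Cmod_mult, Cmod_R.
  apply Rle_lt_trans with (Rabs h * (Cmod v + 1))%R.
  { apply Rmult_le_compat_l; [apply Rabs_pos | lra]. }
  apply Rlt_le_trans with (del / (Cmod v + 1) * (Cmod v + 1))%R; [| right; field; lra].
  now apply Rmult_lt_compat_r.
Qed.

Lemma exists_rotation_to_R (z : C) : exists u, Cmod u = 1%R /\ u * z = RtoC (Cmod z).
Proof.
  destruct (Ceq_dec z 0) as [-> | Hz].
  - exists 1. rewrite Cmod_0, Cmod_1. split; [reflexivity | ring].
  - pose proof (proj1 (Cmod_gt_0 z) Hz) as Hp.
    exists (RtoC (Cmod z) / z). split; [| now field].
    rewrite Cmod_div, Cmod_R, Rabs_pos_eq by (trivial; lra). field. lra.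
Qed.

(** The mean value theorem is a real one, so it is applied to Re (u f) along the segment from [w] to
    [z], where the rotation [u] makes f z - f w real and nonnegative. The derivative is bounded at
    every point of the segment, since the disk of radius [rho] around it stays in the disk of radius
    2 rho around [c]. *)
Lemma cauchy_lipschitz (f : C -> C) (c z w : C) (rho M : R) :
  (0 < rho)%R ->
  (forall z, (Cmod (z - c) < 2 * rho)%R -> cdiff f z /\ (Cmod (f z) <= M)%R) ->
  (Cmod (z - c) < rho)%R -> (Cmod (w - c) < rho)%R ->
  (Cmod (f z - f w) <= 2 * M / rho * Cmod (z - w))%R.
Proof.
  intros Hrho Hf Hz Hw.
  destruct (exists_rotation_to_R (f z - f w)) as (u & Hu & Eu).
  set (v := z - w).
  assert (Hseg : forall t, (0 <= t <= 1)%R -> (Cmod (w + RtoC t * v - c) < rho)%R).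
  { intros t Ht.
    replace (w + RtoC t * v - c) with (RtoC t * (z - c) + RtoC (1 - t) * (w - c))
      by (rewrite RtoC_minus; unfold v; ring).
    eapply Rle_lt_trans; [apply Cmod_triangle |].
    rewrite !Cmod_mult, !Cmod_R, !Rabs_pos_eq by lra.
    destruct (Req_dec t 0) as [-> | Hn]; [lra |].
    assert (t * Cmod (z - c) < t * rho)%R by (apply Rmult_lt_compat_l; lra).
    assert ((1 - t) * Cmod (w - c) <= (1 - t) * rho)%R by (apply Rmult_le_compat_l; lra).
    lra. }
  set (p := fun s : R => Re (u * f (w + RtoC s * v))).
  assert (Hp : forall t, (0 <= t <= 1)%R ->
    exists l, is_derive p t l /\ (Rabs l <= 2 * M / rho * Cmod v)%R).
  { intros t Ht. specialize (Hseg t Ht).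
    destruct (Hf (w + RtoC t * v)) as [[d Hd] _]; [lra |].
    exists (Re (u * d * v)). split; [now apply is_derive_Re_path |].
    eapply Rle_trans; [apply re_le_Cmod |]. rewrite !Cmod_mult, Hu, Rmult_1_l.
    apply Rmult_le_compat_r; [apply Cmod_ge_0 |].
    replace (2 * M / rho)%R with (M / (rho / 2))%R by (field; lra).
    apply (cauchy_deriv_bound f (w + RtoC t * v) d (rho / 2) rho M); trivial; [lra |].
    intros y Hy. apply Hf.
    replace (y - c) with ((y - (w + RtoC t * v)) + (w + RtoC t * v - c)) by ring.
    eapply Rle_lt_trans; [apply Cmod_triangle | lra]. }
  destruct (MVT_gen p 0 1 (Derive p)) as (s & Hs & Es);
    rewrite ?Rmin_left, ?Rmax_right in * by lra.
  - intros t Ht. destruct (Hp t) as (l & Hl & _); [lra |].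
    apply Derive_correct. now exists l.
  - intros t Ht. destruct (Hp t) as (l & Hl & _); [lra |].
    apply continuity_pt_filterlim, (ex_derive_continuous (V := R_NormedModule)). now exists l.
  - destruct (Hp s Hs) as (l & Hl & Bl). apply is_derive_unique in Hl. rewrite Hl in Es.
    assert (E : (p 1 - p 0)%R = Cmod (f z - f w)).
    { unfold p. replace (w + 1 * v) with z by (unfold v; ring).
      replace (w + 0 * v) with w by ring.
      rewrite <- (re_RtoC (Cmod (f z - f w))), <- Eu.
      replace (u * (f z - f w)) with (u * f z - u * f w) by ring.
      unfold Cminus. rewrite re_plus, re_opp. ring. }
    rewrite <- E, Es. pose proof (Rle_abs l). lra.
Qed.

(* Both steps are the Lipschitz bound, first for [f] and then for [f (z + t) - f z]. *)
Lemma second_difference_bound (f : C -> C) (t : C) (rho M : R) :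
  (0 < rho)%R ->
  (forall z, (Cmod z < 2 * rho)%R -> cdiff f z /\ (Cmod (f z) <= M)%R) ->
  (Cmod t < rho / 4)%R ->
  (Cmod (f t + f (- t)%C - 2 * f 0)%C <= 16 * M / rho ^ 2 * Cmod t ^ 2)%R.
Proof.
  intros Hrho Hf Ht.
  assert (Z0 : forall z : C, z - 0 = z) by (intro; ring).
  replace (f t + f (- t) - 2 * f 0) with ((f (0 + t) - f 0) - (f (- t + t) - f (- t))).
  2: { replace (0 + t) with t by ring. replace (- t + t) with (RtoC 0) by ring. ring. }
  (* The outer Lipschitz bound is taken at scale rho / 4: then |z| < rho / 2 and |z + t| < rho,
     where the inner bound 2 M / rho |t| applies. *)
  replace (16 * M / rho ^ 2 * Cmod t ^ 2)%R with
    (2 * (2 * M / rho * Cmod t) / (rho / 4) * Cmod (0 - - t))%R.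
  2: { replace (0 - - t) with t by ring. field. lra. }
  apply (cauchy_lipschitz (fun z => f (z + t) - f z) (RtoC 0)); rewrite ?Z0, ?Cmod_0, ?Cmod_opp; try lra.
  intros z Hz. rewrite Z0 in Hz.
  assert (Hzt : (Cmod (z + t) < rho)%R).
  { eapply Rle_lt_trans; [apply Cmod_triangle | lra]. }
  split.
  - destruct (Hf (z + t)) as [[d1 D1] _]; [lra |]. destruct (Hf z) as [D2 _]; [lra |].
    apply cdiff_plus.
    + apply (cdiff_comp f (fun z => z + t)); [now exists d1 |].
      apply cdiff_plus; [apply cdiff_id | apply cdiff_const].
    + destruct (cdiff_mult (fun _ => - RtoC 1) f z (cdiff_const _ _) D2) as (d & phi & Hc & E & H).
      exists d, phi. split; [exact Hc | split; [exact E |]].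
      intro y. specialize (H y). simpl in H.
      replace (- f y) with (- RtoC 1 * f y) by ring. rewrite H. ring.
  - replace (Cmod t) with (Cmod (z + t - z)) by (f_equal; ring).
    apply cauchy_lipschitz with (RtoC 0); trivial; rewrite ?Z0; try lra.
    intros y Hy. rewrite Z0 in Hy. now apply Hf.
Qed.

Lemma bernoulli_pow (n : nat) (e : R) : (0 <= e <= 1)%R -> (1 - INR n * e <= (1 - e) ^ n)%R.
Proof.
  intro He. induction n as [| n IH]; [simpl; lra |].
  rewrite S_INR. simpl.
  assert (0 <= INR n * e)%R by (apply Rmult_le_pos; [apply pos_INR | lra]).
  assert (0 <= INR n * e * e)%R by (apply Rmult_le_pos; lra).
  apply Rle_trans with ((1 - e) * (1 - INR n * e))%R; [lra |].
  apply Rmult_le_compat_l; lra.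
Qed.

(** On the circle of radius 1 - e the Cauchy bound reads X (1 - e)^n <= 1, and e tends to 0.
    Bernoulli's inequality makes this explicit: if X > 1, the chosen [e] gives n e X < X - 1,
    against X (1 - n e) <= 1. *)
Lemma coef_norm_le_1 (f : C -> C) (n : nat) (r : R) :
  (0 < r < 1)%R -> cdiff_disk f 1 -> (forall z, (Cmod z < 1)%R -> (Cmod (f z) <= 1)%R) ->
  (Cmod (coef f n r) <= 1)%R.
Proof.
  intros Hr Hf Hb. set (X := Cmod (coef f n r)).
  destruct (Rle_lt_dec X 1) as [H | H]; [exact H | exfalso].
  pose proof (pos_INR n) as Hn.
  set (e := Rmin (1 - r) ((X - 1) / (2 * (INR n + 1) * X))).
  assert (HD : (0 < 2 * (INR n + 1) * X)%R) by (apply Rmult_lt_0_compat; lra).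
  assert (He : (0 < e)%R) by (apply Rmin_glb_lt; [lra | apply Rdiv_lt_0_compat; lra]).
  assert (He1 : (e <= 1 - r)%R) by apply Rmin_l.
  assert (He2 : (e <= (X - 1) / (2 * (INR n + 1) * X))%R) by apply Rmin_r.
  assert (HX : (X <= 1 / (1 - e) ^ n)%R).
  { unfold X. rewrite (coef_radius f n r (1 - e) 1) by (trivial; lra).
    apply coef_norm_le with 1%R; trivial; [lra |]. intros z Hz. apply Hb. lra. }
  pose proof (bernoulli_pow n e ltac:(lra)) as Hbern.
  assert (Hpow : (0 < (1 - e) ^ n)%R) by (apply pow_lt; lra).
  apply Rle_div_r in HX; [| lra].
  apply (Rmult_le_compat_r (2 * (INR n + 1) * X)) in He2; [| lra].
  replace ((X - 1) / (2 * (INR n + 1) * X) * (2 * (INR n + 1) * X))%R with (X - 1)%R in He2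
    by (field; lra).
  assert (X * (1 - INR n * e) <= X * (1 - e) ^ n)%R by (apply Rmult_le_compat_l; lra).
  assert (0 <= INR n * e * X)%R by (repeat apply Rmult_le_pos; lra).
  assert (0 < e * X)%R by (apply Rmult_lt_0_compat; lra).
  lra.
Qed.

(** Turns a bound on |a + w b| for all unimodular [w] into the same bound on |a| + |b|. *)
Lemma exists_aligning_rotation (a b : C) :
  exists w, Cmod w = 1%R /\ Cmod (a + w * b) = (Cmod a + Cmod b)%R.
Proof.
  destruct (exists_rotation_to_R a) as (u & Hu & Eu).
  destruct (exists_rotation_to_R b) as (v & Hv & Ev).
  assert (Hu0 : u <> 0) by (apply Cmod_gt_0; lra).
  exists (v / u). split.
  - rewrite Cmod_div, Hu, Hv by exact Hu0. field.
  - replace (a + v / u * b) with ((u * a + v * b) / u) by now field.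
    rewrite Eu, Ev, <- RtoC_plus, Cmod_div, Hu, Cmod_R, Rabs_pos_eq by
      (trivial; pose proof (Cmod_ge_0 a); pose proof (Cmod_ge_0 b); lra).
    field.
Qed.

(** The factor z^(n-m) moves the coefficient of order [m] to order [n] without increasing the
    modulus, so both terms appear in one coefficient of z^(n-m) f + w g, a function bounded by 1,
    with [w] aligning them. *)
Lemma coef_add_le_1 (f g : C -> C) (m n : nat) (r : R) :
  (0 < r < 1)%R -> (m <= n)%nat -> cdiff_disk f 1 -> cdiff_disk g 1 ->
  (forall z, (Cmod z < 1)%R -> (Cmod (f z) + Cmod (g z) <= 1)%R) ->
  (Cmod (coef f m r) + Cmod (coef g n r) <= 1)%R.
Proof.
  intros Hr Hmn Hf Hg Hb.
  destruct (exists_aligning_rotation (coef f m r) (coef g n r)) as (w & Hw & <-).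
  assert (Hsf : cdiff_disk (fun z => z ^ (n - m) * f z) 1).
  { intros z Hz. apply cdiff_mult; [apply cdiff_pow, cdiff_id | now apply Hf]. }
  rewrite <- (coef_shift f (n - m) m r) by lra.
  replace (n - m + m)%nat with n by lia.
  rewrite <- (coef_lin _ _ _ _ _ 1) by (trivial; lra).
  apply coef_norm_le_1; trivial.
  - intros z Hz. apply cdiff_plus; [now apply Hsf |].
    apply cdiff_mult; [apply cdiff_const | now apply Hg].
  - intros z Hz. eapply Rle_trans; [apply Cmod_triangle |].
    rewrite !Cmod_mult, Hw, Cmod_pow, Rmult_1_l.
    specialize (Hb z Hz).
    assert (Cmod z ^ (n - m) * Cmod (f z) <= 1 * Cmod (f z))%R.
    { apply Rmult_le_compat_r; [apply Cmod_ge_0 |].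
      rewrite <- (pow1 (n - m)). apply pow_incr. split; [apply Cmod_ge_0 | lra]. }
    lra.
Qed.

(** * A pair of extensions on the symmetrized bidisc *)

(** Half-angle formulas for the real and imaginary parts; the sign of [b] decides the relative
    sign. *)
Lemma exists_Csqrt (w : C) : exists v : C, v * v = w.
Proof.
  destruct w as [a b].
  set (m := Cmod (a, b)).
  assert (Hm : (m * m = a * a + b * b)%R).
  { unfold m, Cmod. cbn [fst snd]. rewrite sqrt_sqrt; [ring | nra]. }
  pose proof (Rabs_fst_le_Cmod (a, b)) as Ha. fold m in Ha. simpl in Ha.
  apply Rabs_le_between in Ha.
  set (x := sqrt ((m + a) / 2)). set (y := sqrt ((m - a) / 2)).
  assert (Hx : (x * x = (m + a) / 2)%R) by (apply sqrt_sqrt; lra).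
  assert (Hy : (y * y = (m - a) / 2)%R) by (apply sqrt_sqrt; lra).
  assert (Hxy : (x * y = Rabs b / 2)%R).
  { unfold x, y. rewrite <- sqrt_mult by lra.
    replace ((m + a) / 2 * ((m - a) / 2))%R with (Rsqr (b / 2)).
    - rewrite sqrt_Rsqr_abs. unfold Rdiv. rewrite Rabs_mult. rewrite (Rabs_pos_eq (/ 2)); lra.
    - unfold Rsqr. transitivity ((m * m - a * a) / 4)%R; [rewrite Hm |]; field. }
  destruct (Rle_lt_dec 0 b) as [Hb | Hb].
  - exists (x, y). rewrite Rabs_pos_eq in Hxy by exact Hb.
    unfold Cmult; simpl. f_equal; lra.
  - exists (x, (- y)%R). rewrite Rabs_left in Hxy by exact Hb.
    unfold Cmult; simpl. f_equal; lra.
Qed.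

(** [z] is a root of z^2 - t z + 1; the product of the two roots is 1, so the other one is [/ z]. *)
Lemma exists_joukowski (t : C) : exists z : C, z <> 0 /\ t = z + / z.
Proof.
  destruct (exists_Csqrt (t * t - 4)) as [v Hv].
  assert (Hp : (t + v) / 2 * ((t - v) / 2) = 1).
  { transitivity ((t * t - v * v) / 4); [field | rewrite Hv; field]. }
  exists ((t + v) / 2). split.
  - intro E. rewrite E, Cmult_0_l in Hp. now apply C1_nz.
  - assert (Hz : (t + v) / 2 <> 0).
    { intro E. rewrite E, Cmult_0_l in Hp. now apply C1_nz. }
    replace (/ ((t + v) / 2)) with ((t - v) / 2).
    + field.
    + rewrite <- (Cmult_1_l (/ ((t + v) / 2))), <- Hp.
      set (a := (t + v) / 2) in *. now field.
Qed.

(** With t = z + 1/z the point is the symmetrization of l z and l / z. If |z| >= 1/r, then |t| >=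
    |z| - 1/|z| >= 1/r - r, which is excluded; the condition is symmetric in z and 1/z, so both
    coordinates lie in the disk. *)
Lemma sym_bidisc_complex_slice (l t : C) (r : R) :
  (0 < r < 1)%R -> (Cmod l <= r)%R -> (Cmod t < 1 / r - r)%R -> sym_bidisc (l * t, l * l).
Proof.
  intros Hr Hl Ht.
  destruct (exists_joukowski t) as (z & Hz & ->).
  assert (K : forall z : C, z <> 0 -> (Cmod (z + / z) < 1 / r - r)%R -> unit_disk (l * z)).
  { clear z Hz Ht. intros z Hz Ht. unfold unit_disk. rewrite Cmod_mult.
    pose proof (proj1 (Cmod_gt_0 z) Hz) as Hp.
    destruct (Rle_lt_dec (1 / r) (Cmod z)) as [H | H].
    - exfalso.
      assert (H1 : (Cmod z <= Cmod (z + / z) + / Cmod z)%R).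
      { rewrite <- Cmod_inv by exact Hz.
        replace z with (z + / z + - / z) at 1 by ring.
        rewrite <- (Cmod_opp (/ z)). apply Cmod_triangle. }
      assert (H2 : (/ Cmod z <= r)%R).
      { rewrite <- (Rinv_inv r). apply Rinv_le_contravar.
        - apply Rinv_0_lt_compat; lra.
        - unfold Rdiv in H. lra. }
      lra.
    - apply Rle_lt_trans with (r * Cmod z)%R.
      + apply Rmult_le_compat_r; lra.
      + apply (Rmult_lt_compat_l r) in H; [| lra].
        replace (r * (1 / r))%R with 1%R in H by (field; lra). exact H. }
  assert (Hi : / z <> 0).
  { intro E. apply C1_nz. rewrite <- (Cinv_r z Hz), E. ring. }
  exists (l * z), (l * / z). split; [| split].
  - now apply K.
  - apply K; trivial. replace (/ z + / / z) with (z + / z); trivial.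
    now field.
  - f_equal; [ring | now field].
Qed.

(** The numbers x/2 + i y and x/2 - i y are unimodular, with sum [x] and product 1. Hence the whole
    disk of [l] is available, in contrast with the complex slice. *)
Lemma sym_bidisc_real_slice (l : C) (x : R) :
  (Cmod l < 1)%R -> (Rabs x <= 2)%R -> sym_bidisc (l * RtoC x, l * l).
Proof.
  intros Hl Hx. apply Rabs_le_between in Hx.
  set (y := sqrt (1 - x * x / 4)).
  assert (Hy : (y * y = 1 - x * x / 4)%R) by (apply sqrt_sqrt; nra).
  assert (H1 : forall s : R, (s * s = 1 - x * x / 4)%R -> Cmod ((x / 2)%R, s) = 1%R).
  { intros s Hs. unfold Cmod. cbn [fst snd]. rewrite <- sqrt_1. f_equal. nra. }
  exists (l * ((x / 2)%R, y)), (l * ((x / 2)%R, (- y)%R)).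
  unfold unit_disk. rewrite !Cmod_mult, !H1, Rmult_1_r by (trivial; lra).
  split; [exact Hl | split; [exact Hl |]].
  f_equal.
  - rewrite <- Cmult_plus_distr_l. f_equal. unfold Cplus, RtoC; simpl. f_equal; field.
  - assert (E : ((x / 2)%R, y) * ((x / 2)%R, (- y)%R) = RtoC 1).
    { unfold Cmult, RtoC; simpl. f_equal; [| ring].
      replace (x / 2 * (x / 2) - y * - y)%R with (x * x / 4 + y * y)%R by field. lra. }
    transitivity (l * l * (((x / 2)%R, y) * ((x / 2)%R, (- y)%R))); [rewrite E |]; ring.
Qed.

Definition cdiff2_on (U : C * C -> Prop) (F : C * C -> C) : Prop := forall q, U q -> cdiff2 F q.

Lemma cderiv_slice (x : C) (l : C) : cderiv (fun l => l * x) l x.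
Proof.
  exists (fun _ => x). split; [apply continuous_const | split; [reflexivity |]].
  intro; ring.
Qed.

Lemma cdiff_real_slice (F : C * C -> C) (x : R) :
  cdiff2_on sym_bidisc F -> (Rabs x <= 2)%R ->
  cdiff_disk (fun l => F (l * RtoC x, l * l)) 1.
Proof.
  intros HF Hx l Hl. apply (cdiff_comp2 F (fun l => l * RtoC x) (fun l => l * l)).
  - apply HF. now apply sym_bidisc_real_slice.
  - eexists; apply cderiv_slice.
  - apply cdiff_mult; apply cdiff_id.
Qed.

Lemma cdiff_disk_add (f g : C -> C) (c : C) (R0 : R) :
  cdiff_disk f R0 -> cdiff_disk g R0 -> cdiff_disk (fun z => f z + c * g z) R0.
Proof.
  intros Hf Hg z Hz. apply cdiff_plus; [now apply Hf |].
  apply cdiff_mult; [apply cdiff_const | now apply Hg].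
Qed.

(* [A] is of first order in [s] at [s = 0] while [|A| + |B| <= 1]; so the modulus of the
   2k-th Taylor coefficient of [l |-> B (l x, l^2)] drops linearly in [x] from its
   value at [x = 0], whereas Cauchy's estimates make it vary quadratically. *)
Lemma coupled_extensions_bound (A B : C * C -> C) (e1 e2 d : C) (k : nat) (r : R) :
  (2 <= k)%nat -> (1 / 2 <= r < 1)%R ->
  cdiff2_on sym_bidisc A -> cdiff2_on sym_bidisc B ->
  (forall q, sym_bidisc q -> (Cmod (A q) + Cmod (B q) <= 1)%R) ->
  (forall l, unit_disk l -> A (2 * l, l * l) = l * (e1 + e2 * l)) ->
  (forall m, unit_disk m -> B (RtoC 0, m) = (m ^ k - d * m) / RtoC (1 + Cmod d)) ->
  (Cmod e1 ^ 2 * r ^ (2 * k) * (1 / r - r) ^ 2 <= 512 * Cmod d)%R.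
Proof.
  intros Hk Hr HA HB Hsum HAr HBf.
  pose proof (Cmod_ge_0 d) as Hd0.
  set (a := fun x : R => fun l => A (l * RtoC x, l * l)).
  set (b := fun x : R => fun l => B (l * RtoC x, l * l)).
  assert (Ha : forall x, (Rabs x <= 2)%R -> cdiff_disk (a x) 1)
    by (intros; now apply cdiff_real_slice).
  assert (Hb : forall x, (Rabs x <= 2)%R -> cdiff_disk (b x) 1)
    by (intros; now apply cdiff_real_slice).
  assert (G0 : sym_bidisc (RtoC 0 * RtoC 0, RtoC 0 * RtoC 0)).
  { apply (sym_bidisc_real_slice 0 0); rewrite ?Cmod_0, ?Rabs_R0; lra. }
  destruct (HA _ G0) as (c1 & c2 & HA0).
  (* The second coordinate [l * l] has derivative 0 at 0, so only the first partial derivative [c1]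
     of [A] survives. *)
  assert (Ca : forall x, (Rabs x <= 2)%R -> coef (a x) 1 r = c1 * RtoC x).
  { intros x Hx. apply coef_deriv with 1%R; [lra | now apply Ha |].
    replace (c1 * RtoC x) with (c1 * RtoC x + c2 * (0 * 1 + 0 * 1)) by ring.
    apply (cderiv_comp2 A (fun l => l * RtoC x) (fun l => l * l)).
    - now replace (0 * RtoC x) with (0 * 0) by ring.
    - apply cderiv_slice.
    - apply cderiv_mult; apply cderiv_id. }
  (* The slice x = 2 is the royal disk, where [A] is prescribed; this determines [c1]. *)
  assert (Hc1 : c1 * 2 = e1).
  { rewrite <- (Ca 2%R) by (rewrite Rabs_pos_eq; lra).
    rewrite (coef_ext _ (fun l => e1 * (l * 1) + e2 * (l * (l * 1)))); [| lra |].
    - apply coef_deriv with 1%R; [lra | |].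
      + intros l _. apply cdiff_plus; (apply cdiff_mult; [apply cdiff_const |]);
          repeat apply cdiff_mult; first [apply cdiff_id | apply cdiff_const].
      + exists (fun l => e1 + e2 * l). split; [| split].
        * apply continuous_Cplus; [apply continuous_const |].
          apply continuous_Cmult; [apply continuous_const | apply continuous_id].
        * ring.
        * intro; ring.
    - intros l Hl. unfold a. replace (l * RtoC 2) with (2 * l) by ring.
      rewrite HAr by (unfold unit_disk; lra). ring. }
  set (y := fun x : R => coef (b x) (2 * k) r).
  assert (Hay : forall x, (Rabs x <= 2)%R -> (Cmod e1 / 2 * Rabs x + Cmod (y x) <= 1)%R).
  { intros x Hx.
    replace (Cmod e1 / 2 * Rabs x)%R with (Cmod (coef (a x) 1 r)).
    - unfold y. apply (coef_add_le_1 (a x) (b x) 1 (2 * k) r); [lra | lia | now apply Ha | now apply Hb |].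
      intros l Hl. apply Hsum, sym_bidisc_real_slice; assumption.
    - rewrite Ca, <- Hc1, !Cmod_mult, !Cmod_R, (Rabs_pos_eq 2) by (trivial; lra). field. }
  assert (Hy0 : Cmod (y 0%R) = (/ (1 + Cmod d))%R).
  { unfold y.
    (* B (0, l^2) is put in the shape required by two uses of [coef_lin], hence the zero term. As k
       >= 2, the term in l^2 has no coefficient of order 2k. *)
    rewrite (coef_ext _ (fun l => (fun l => 0 * l ^ (2 * k) + / RtoC (1 + Cmod d) * l ^ (2 * k)) l
      + - d / RtoC (1 + Cmod d) * l ^ 2)); [| lra |].
    - rewrite (coef_lin _ (fun l => l ^ 2) _ _ _ 1); [| lra | |].
      + rewrite (coef_lin (fun l => 0 * l ^ (2 * k)) (fun l => l ^ (2 * k)) _ _ _ 1); [| lra | |].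
        * rewrite coef_pow_eq, (coef_pow_lt 2) by (lra || lia).
          rewrite (coef_ext _ (fun l => l ^ 2 + - RtoC 1 * l ^ 2)) by first [lra | intros; ring].
          rewrite (coef_lin (fun l => l ^ 2) (fun l => l ^ 2) _ _ _ 1);
            try (lra || (intros l _; apply cdiff_pow, cdiff_id)).
          rewrite (coef_pow_lt 2) by (lra || lia).
          replace (0 + - RtoC 1 * 0 + / RtoC (1 + Cmod d) * 1 + - d / RtoC (1 + Cmod d) * 0)
            with (/ RtoC (1 + Cmod d)) by ring.
          rewrite <- RtoC_inv, Cmod_R, Rabs_pos_eq; trivial; [| lra].
          left. apply Rinv_0_lt_compat; lra.
        * intros l _. apply cdiff_mult; [apply cdiff_const | apply cdiff_pow, cdiff_id].
        * intros l _. apply cdiff_pow, cdiff_id.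
      + apply cdiff_disk_add; intros l _.
        * apply cdiff_mult; [apply cdiff_const | apply cdiff_pow, cdiff_id].
        * apply cdiff_pow, cdiff_id.
      + intros l _. apply cdiff_pow, cdiff_id.
    - intros l Hl. unfold b. replace (l * 0) with (RtoC 0) by ring.
      rewrite HBf.
      + rewrite Cpow_mult_r. simpl. unfold Cdiv. rewrite Cmult_1_r. ring.
      + unfold unit_disk. rewrite Cmod_mult, Hl. nra. }
  set (s := (1 / r - r)%R).
  (* The bound r >= 1/2 enters here: it keeps x < s / 8 inside the range |x| <= 2 of the real
     slices. *)
  assert (Hs : (0 < s <= 3 / 2)%R).
  { unfold s. assert (1 < 1 / r)%R by (apply Rlt_div_r; lra).
    assert (1 / r <= 2)%R by (apply Rle_div_l; lra). lra. }
  set (P := (r ^ (2 * k))%R).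
  assert (HP : (0 < P <= 1)%R).
  { unfold P. split; [apply pow_lt; lra |].
    rewrite <- (pow1 (2 * k)). apply pow_incr. lra. }
  (* For |l| = r the function t |-> B (l t, l^2) is bounded by 1 on |t| < s, so
     [second_difference_bound] applies with rho = s / 2: this gives 16 / (s / 2)^2 = 64 / s^2 and
     the range x < rho / 4. The division by [P] is the passage to the coefficient of order 2k. *)
  assert (Hdiff : forall x, (0 <= x < s / 8)%R ->
    (Cmod (y x + 1 * y (- x)%R + - 2 * y 0%R)%C <= 64 / s ^ 2 * x ^ 2 / P)%R).
  { intros x Hx. unfold y.
    assert (Rabs x <= 2)%R by (rewrite Rabs_pos_eq; lra).
    assert (Rabs (- x) <= 2)%R by now rewrite Rabs_Ropp.
    assert (Rabs 0 <= 2)%R by (rewrite Rabs_R0; lra).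
    rewrite <- (coef_lin (b x) (b (- x)%R) _ _ _ 1) by (lra || auto).
    rewrite <- (coef_lin _ (b 0%R) _ _ _ 1) by (lra || auto || (apply cdiff_disk_add; auto)).
    apply coef_norm_le with 1%R; [lra | repeat apply cdiff_disk_add; auto |].
    intros l Hl. unfold b.
    replace (64 / s ^ 2 * x ^ 2)%R with (16 * 1 / (s / 2) ^ 2 * Cmod (RtoC x) ^ 2)%R
      by (rewrite Cmod_R, Rabs_pos_eq by lra; field; lra).
    match goal with |- (Cmod ?z <= _)%R => replace z with
      (B (l * RtoC x, l * l) + B (l * - RtoC x, l * l) - 2 * B (l * RtoC 0, l * l))
      by (rewrite RtoC_opp; ring) end.
    apply (second_difference_bound (fun t => B (l * t, l * l))); [lra | |].
    - intros t Ht.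
      assert (Hg : sym_bidisc (l * t, l * l)).
      { apply sym_bidisc_complex_slice with r; [lra | lra |]. fold s. lra. }
      split.
      + apply (cdiff_comp2 B (fun t => l * t) (fun _ => l * l)).
        * now apply HB.
        * apply cdiff_mult; [apply cdiff_const | apply cdiff_id].
        * apply cdiff_const.
      + specialize (Hsum _ Hg). pose proof (Cmod_ge_0 (A (l * t, l * l))). lra.
    - rewrite Cmod_R, Rabs_pos_eq; lra. }
  assert (He1 : (Cmod e1 <= 1)%R).
  { specialize (Hay 2%R). rewrite Rabs_pos_eq in Hay by lra.
    pose proof (Cmod_ge_0 (y 2%R)). lra. }
  pose proof (Cmod_ge_0 e1) as He0.
  (* Adding [Hay] at x and -x gives a total drop |e1| x; this [x] makes the second difference bound
     64 x^2 / (s^2 P) equal to half of it. What remains is |e1| x / 2 <= 2 - 2 / (1 + |d|) <= 2 |d|,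
     whence the constant 512 = 4 * 128. *)
  set (x := (Cmod e1 * P * s ^ 2 / 128)%R).
  assert (Hq : (0 <= Cmod e1 * P <= 1)%R) by nra.
  assert (Hx : (0 <= x < s / 8)%R).
  { unfold x. assert (0 <= Cmod e1 * P * s ^ 2 <= s ^ 2)%R by nra. nra. }
  specialize (Hdiff x Hx).
  assert (Hx2 : (Rabs x <= 2)%R) by (rewrite Rabs_pos_eq; lra).
  pose proof (Hay x Hx2) as H1.
  pose proof (Hay (- x)%R ltac:(now rewrite Rabs_Ropp)) as H2.
  rewrite Rabs_Ropp in H2. rewrite (Rabs_pos_eq x) in H1, H2 by lra.
  assert (H3 : (2 * Cmod (y 0%R) <=
    Cmod (y x + 1 * y (- x)%R + - 2 * y 0%R)%C + (Cmod (y x) + Cmod (y (- x)%R)))%R).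
  { replace (2 * Cmod (y 0%R))%R with (Cmod (2 * y 0%R)%C)
      by (rewrite Cmod_mult, Cmod_R, Rabs_pos_eq; lra).
    replace (2 * y 0%R)%C with
      (- (y x + 1 * y (- x)%R + - 2 * y 0%R) + (y x + y (- x)%R)) by ring.
    eapply Rle_trans; [apply Cmod_triangle |]. rewrite Cmod_opp.
    apply Rplus_le_compat_l, Cmod_triangle. }
  rewrite Hy0 in H3.
  assert (H4 : (1 - Cmod d <= / (1 + Cmod d))%R).
  { apply Rmult_le_reg_r with (1 + Cmod d)%R; [lra |]. rewrite Rinv_l by lra. nra. }
  assert (H5 : (64 / s ^ 2 * x ^ 2 / P = Cmod e1 * x / 2)%R).
  { unfold x. field. split; lra. }
  rewrite H5 in Hdiff.
  assert (H6 : (Cmod e1 * x / 2 <= 2 * Cmod d)%R) by lra.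
  unfold x in H6. fold s. nra.
Qed.

(** * Holomorphy in the sense of filterdiff *)

Local Notation C2 := (prod_NormedModule C_AbsRing C_NormedModule C_NormedModule).

Lemma norm_C2 (s p : C) : @norm C_AbsRing C2 (s, p) = sqrt (Cmod s ^ 2 + Cmod p ^ 2).
Proof. reflexivity. Qed.

Lemma Cmod_fst_le_norm (s p : C) : (Cmod s <= @norm C_AbsRing C2 (s, p))%R.
Proof.
  rewrite norm_C2, <- (sqrt_pow2 (Cmod s)) at 1 by apply Cmod_ge_0.
  apply sqrt_le_1_alt. pose proof (pow2_ge_0 (Cmod p)). lra.
Qed.

Lemma Cmod_snd_le_norm (s p : C) : (Cmod p <= @norm C_AbsRing C2 (s, p))%R.
Proof.
  rewrite norm_C2, <- (sqrt_pow2 (Cmod p)) at 1 by apply Cmod_ge_0.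
  apply sqrt_le_1_alt. pose proof (pow2_ge_0 (Cmod s)). lra.
Qed.

(** The remainder [e] of the linear approximation must be split along the two coordinate increments
    h1 and h2. As N = h1 conj(h1) + h2 conj(h2), it equals (e conj(h1) / N) h1 + (e conj(h2) / N)
    h2, and both factors tend to 0 because e = o(sqrt N). *)
Lemma cdiff2_of_ex_filterdiff (F : C * C -> C) (q : C * C) :
  ex_filterdiff (K := C_AbsRing) (U := C2) (V := C_NormedModule) F (locally q) -> cdiff2 F q.
Proof.
  intros [l [Hl Hdom]].
  assert (Hq : is_filter_lim (T := C2) (locally q) q) by (intros P HP; exact HP).
  specialize (Hdom q Hq).
  destruct q as [s0 p0].
  set (a := l (RtoC 1, RtoC 0)). set (b := l (RtoC 0, RtoC 1)).
  assert (El : forall s p : C, l (s, p) = a * s + b * p).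
  { intros s p.
    replace (s, p) with (plus (scal s (RtoC 1, RtoC 0) : C2) (scal p (RtoC 0, RtoC 1) : C2)).
    - rewrite (linear_plus l Hl), !(linear_scal l Hl).
      change (s * a + p * b = a * s + b * p). ring.
    - change ((s * 1 + p * 0, s * 0 + p * 1) = (s, p)). f_equal; ring. }
  set (e := fun q : C * C => F q - F (s0, p0) - (a * (fst q - s0) + b * (snd q - p0))).
  set (N := fun q : C * C => (Cmod (fst q - s0) ^ 2 + Cmod (snd q - p0) ^ 2)%R).
  assert (He : forall eps, (0 < eps)%R ->
    locally (T := prod_UniformSpace C_UniformSpace C_UniformSpace) (s0, p0)
      (fun q => (Cmod (e q) <= eps * sqrt (N q))%R)).
  { intros eps Heps. generalize (Hdom (mkposreal eps Heps)). apply filter_imp.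
    intros [s p] H. unfold e, N. cbn [fst snd pos] in *.
    rewrite <- El. exact H. }
  assert (HN : forall q, (0 <= N q)%R).
  { intro q. unfold N. pose proof (pow2_ge_0 (Cmod (fst q - s0))).
    pose proof (pow2_ge_0 (Cmod (snd q - p0))). lra. }
  assert (HN0 : forall q, N q = 0%R -> q = (s0, p0)).
  { intros [s p] H. unfold N in H. cbn [fst snd] in H.
    pose proof (pow2_ge_0 (Cmod (s - s0))). pose proof (pow2_ge_0 (Cmod (p - p0))).
    assert (E1 : Cmod (s - s0) = 0%R) by (apply Rsqr_0_uniq; unfold Rsqr; lra).
    assert (E2 : Cmod (p - p0) = 0%R) by (apply Rsqr_0_uniq; unfold Rsqr; lra).
    apply Cmod_eq_0 in E1, E2. apply Ceq_minus in E1, E2. now rewrite E1, E2. }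
  assert (e0 : e (s0, p0) = 0) by (unfold e; cbn [fst snd]; ring).
  (* [g] stands for the conjugate of either coordinate increment. *)
  assert (Cont : forall (c : C) (g : C * C -> C),
    (forall q, (Cmod (g q) <= sqrt (N q))%R) ->
    continuous (T := prod_UniformSpace C_UniformSpace C_UniformSpace) (U := C_UniformSpace)
      (fun q => c + e q * g q / RtoC (N q)) (s0, p0)).
  { intros c g Hg. apply continuous_to_C_eps. intros eps Heps.
    generalize (He (eps / 2)%R ltac:(lra)). apply filter_imp. intros q Hq'.
    rewrite e0. replace (c + e q * g q / RtoC (N q) - (c + 0 * g (s0, p0) / RtoC (N (s0, p0))))
      with (e q * g q / RtoC (N q)) by (unfold Cdiv; ring).
    destruct (Req_dec (N q) 0) as [Hz | Hz].
    - rewrite (HN0 q Hz), e0. replace (0 * g (s0, p0) / RtoC (N (s0, p0))) with (RtoC 0)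
        by (unfold Cdiv; ring). rewrite Cmod_0. exact Heps.
    - specialize (HN q). specialize (Hg q).
      assert (Hs : (sqrt (N q) * sqrt (N q) = N q)%R) by (apply sqrt_sqrt; exact HN).
      pose proof (sqrt_pos (N q)).
      rewrite Cmod_div by (intro E; now apply RtoC_inj in E).
      rewrite Cmod_mult, Cmod_R, Rabs_pos_eq by exact HN.
      apply Rle_lt_trans with (eps / 2)%R; [| lra].
      apply Rle_div_l; [lra |].
      apply Rle_trans with (eps / 2 * sqrt (N q) * sqrt (N q))%R.
      + apply Rmult_le_compat; trivial; apply Cmod_ge_0.
      + right. rewrite Rmult_assoc, Hs. reflexivity. }
  exists a, b,
    (fun q => a + e q * Cconj (fst q - s0) / RtoC (N q)),
    (fun q => b + e q * Cconj (snd q - p0) / RtoC (N q)).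
  split; [| split; [| split; [| split]]].
  - apply Cont. intros [s p]. rewrite Cmod_conj. apply (Cmod_fst_le_norm (s - s0) (p - p0)).
  - apply Cont. intros [s p]. rewrite Cmod_conj. apply (Cmod_snd_le_norm (s - s0) (p - p0)).
  - rewrite e0. unfold Cdiv. ring.
  - rewrite e0. unfold Cdiv. ring.
  - intros q. cbn [fst snd].
    destruct (Req_dec (N q) 0) as [Hz | Hz].
    + rewrite (HN0 q Hz), e0. cbn [fst snd]. ring.
    + assert (EN : RtoC (N q) =
        (fst q - s0) * Cconj (fst q - s0) + (snd q - p0) * Cconj (snd q - p0)).
      { unfold N. rewrite RtoC_plus, !Cmod2_conj. reflexivity. }
      assert (Hz' : RtoC (N q) <> 0) by (intro E; now apply RtoC_inj in E).
      transitivity (F (s0, p0) + (a * (fst q - s0) + b * (snd q - p0)) +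
        e q * ((fst q - s0) * Cconj (fst q - s0) + (snd q - p0) * Cconj (snd q - p0)) /
        RtoC (N q)).
      * rewrite <- EN. replace (e q * RtoC (N q) / RtoC (N q)) with (e q) by now field.
        unfold e. ring.
      * unfold Cdiv. ring.
Qed.

Lemma ex_filterdiff_of_cdiff2 (F : C * C -> C) (q : C * C) :
  cdiff2 F q -> ex_filterdiff (K := C_AbsRing) (U := C2) (V := C_NormedModule) F (locally q).
Proof.
  intros (a & b & phi & psi & Cphi & Cpsi & Ea & Eb & HF).
  exists (fun v : C2 => a * fst v + b * snd v).
  split.
  - constructor.
    + intros [s1 p1] [s2 p2].
      change (a * (s1 + s2) + b * (p1 + p2) = a * s1 + b * p1 + (a * s2 + b * p2)). ring.
    + intros k [s p].
      change (a * (k * s) + b * (k * p) = k * (a * s + b * p)). ring.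
    + exists (Cmod a + Cmod b + 1)%R.
      pose proof (Cmod_ge_0 a). pose proof (Cmod_ge_0 b). split; [lra |].
      intros [s p].
      change (Cmod (a * s + b * p) <= (Cmod a + Cmod b + 1) * @norm C_AbsRing C2 (s, p))%R.
      pose proof (Cmod_fst_le_norm s p) as N1. pose proof (Cmod_snd_le_norm s p) as N2.
      set (n := @norm C_AbsRing C2 (s, p)).
      change (Cmod s <= n)%R in N1. change (Cmod p <= n)%R in N2.
      pose proof (Cmod_ge_0 s).
      eapply Rle_trans; [apply Cmod_triangle |]. rewrite !Cmod_mult.
      assert (Cmod a * Cmod s <= Cmod a * n)%R by (apply Rmult_le_compat_l; lra).
      assert (Cmod b * Cmod p <= Cmod b * n)%R by (apply Rmult_le_compat_l; lra).
      lra.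
  - intros x Hx. apply (is_filter_lim_locally_unique (V := C2)) in Hx. subst x.
    intros eps.
    assert (Hh : (0 < eps / 2)%R) by (pose proof (cond_pos eps); lra).
    apply continuous_to_C_eps with (e := (eps / 2)%R) in Cphi; [| exact Hh].
    apply continuous_to_C_eps with (e := (eps / 2)%R) in Cpsi; [| exact Hh].
    generalize (filter_and _ _ Cphi Cpsi). apply filter_imp.
    intros [s p] [H1 H2]. destruct q as [s0 p0].
    change (Cmod (F (s, p) - F (s0, p0) - (a * (s - s0) + b * (p - p0))) <=
      eps * @norm C_AbsRing C2 ((s - s0)%C, (p - p0)%C))%R.
    pose proof (Cmod_fst_le_norm (s - s0) (p - p0)) as N1.
    pose proof (Cmod_snd_le_norm (s - s0) (p - p0)) as N2.
    set (n := @norm C_AbsRing C2 ((s - s0)%C, (p - p0)%C)).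
    change (Cmod (s - s0) <= n)%R in N1. change (Cmod (p - p0) <= n)%R in N2.
    pose proof (Cmod_ge_0 (s - s0)). pose proof (Cmod_ge_0 (p - p0)).
    rewrite (HF (s, p)). cbn [fst snd].
    replace (F (s0, p0) + phi (s, p) * (s - s0) + psi (s, p) * (p - p0) - F (s0, p0) -
      (a * (s - s0) + b * (p - p0))) with
      ((phi (s, p) - phi (s0, p0)) * (s - s0) + (psi (s, p) - psi (s0, p0)) * (p - p0))
      by (rewrite Ea, Eb; ring).
    eapply Rle_trans; [apply Cmod_triangle |]. rewrite !Cmod_mult.
    assert (Cmod (phi (s, p) - phi (s0, p0)) * Cmod (s - s0) <= eps / 2 * n)%R
      by (apply Rmult_le_compat; trivial; [apply Cmod_ge_0 | lra]).
    assert (Cmod (psi (s, p) - psi (s0, p0)) * Cmod (p - p0) <= eps / 2 * n)%R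
      by (apply Rmult_le_compat; trivial; [apply Cmod_ge_0 | lra]).
    lra.
Qed.

(** Applied to the denominator of an automorphism, this yields the open sets asked for in
    [holomorphic_sub]. *)
Lemma open_neq_0 (D : C * C -> C) :
  (forall q, cdiff2 D q) ->
  open (T := prod_UniformSpace C_UniformSpace C_UniformSpace) (fun q => D q <> 0).
Proof.
  intros HD q Hq.
  pose proof (cdiff2_continuous _ _ (HD q)) as Hc.
  apply Cmod_gt_0 in Hq.
  apply continuous_to_C_eps with (e := Cmod (D q)) in Hc; [| exact Hq].
  revert Hc. apply filter_imp. intros q' H E. rewrite E in H.
  replace (0 - D q) with (- D q) in H by ring. rewrite Cmod_opp in H. lra.
Qed.

(** * Automorphisms of the symmetrized bidisc *)

Definition moebius (g z : C) : C := (z + g) / (1 + Cconj g * z).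

Lemma moebius_den (g z : C) : unit_disk g -> unit_disk z -> 1 + Cconj g * z <> 0.
Proof.
  unfold unit_disk. intros Hg Hz E.
  assert (H : Cconj g * z = - RtoC 1).
  { replace (Cconj g * z) with (1 + Cconj g * z - 1) by ring. rewrite E. ring. }
  apply (f_equal Cmod) in H. rewrite Cmod_mult, Cmod_conj, Cmod_opp, Cmod_1 in H.
  pose proof (Cmod_ge_0 g). pose proof (Cmod_ge_0 z). nra.
Qed.

(** Rests on the identity |1 + conj(g) z|^2 - |z + g|^2 = (1 - |z|^2) (1 - |g|^2). *)
Lemma moebius_disk (g z : C) : unit_disk g -> unit_disk z -> unit_disk (moebius g z).
Proof.
  intros Hg Hz. pose proof (moebius_den g z Hg Hz) as Hd.
  unfold unit_disk, moebius in *. rewrite Cmod_div by exact Hd.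
  apply Cmod_gt_0 in Hd.
  apply Rlt_div_l; [exact Hd |]. rewrite Rmult_1_l.
  apply Rsqr_incrst_0; try apply Cmod_ge_0. unfold Rsqr.
  replace (Cmod (z + g) * Cmod (z + g))%R with (Cmod (z + g) ^ 2)%R by ring.
  set (w := 1 + Cconj g * z) in *.
  replace (Cmod w * Cmod w)%R with (Cmod w ^ 2)%R by ring. unfold w.
  pose proof (Cmod2_alt z) as Ez. pose proof (Cmod2_alt g) as Eg.
  rewrite !Cmod2_alt. rewrite !re_plus, !im_plus, re_mult, im_mult, re_conj, im_conj.
  rewrite re_RtoC, im_RtoC.
  pose proof (Cmod_ge_0 g). pose proof (Cmod_ge_0 z).
  assert (0 < (1 - Cmod z ^ 2) * (1 - Cmod g ^ 2))%R by (apply Rmult_lt_0_compat; nra).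
  rewrite Ez, Eg in *. nra.
Qed.

Lemma unit_disk_opp (z : C) : unit_disk z -> unit_disk (- z).
Proof. unfold unit_disk. now rewrite Cmod_opp. Qed.

Lemma moebius_opp_den (g z : C) : unit_disk g -> 1 - Cconj g * g <> 0.
Proof.
  intros Hg E. apply (moebius_den (- g) g (unit_disk_opp _ Hg) Hg).
  rewrite Copp_conj. rewrite <- E. ring.
Qed.

Lemma moebius_inv (g z : C) : unit_disk g -> unit_disk z -> moebius (- g) (moebius g z) = z.
Proof.
  intros Hg Hz. pose proof (moebius_den g z Hg Hz) as H1.
  pose proof (moebius_opp_den g z Hg) as H2.
  unfold moebius. rewrite Copp_conj.
  assert (H3 : 1 + - Cconj g * ((z + g) / (1 + Cconj g * z)) =
    (1 - Cconj g * g) / (1 + Cconj g * z)) by now field.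
  rewrite H3. field. split; assumption.
Qed.

(* The automorphism (z + w, z w) |-> (m z + m w, m z * m w) of the symmetrized bidisc,
   [m] being [moebius g], in the coordinates (s, p). *)
Definition aut_den (g : C) (q : C * C) : C := 1 + Cconj g * fst q + Cconj g * Cconj g * snd q.

Definition aut_s (g : C) (q : C * C) : C :=
  ((1 + g * Cconj g) * fst q + 2 * Cconj g * snd q + 2 * g) / aut_den g q.

Definition aut_p (g : C) (q : C * C) : C := (snd q + g * fst q + g * g) / aut_den g q.

Definition aut (g : C) (q : C * C) : C * C := (aut_s g q, aut_p g q).

Lemma aut_den_sym (g z w : C) :
  aut_den g (z + w, z * w) = (1 + Cconj g * z) * (1 + Cconj g * w).
Proof. unfold aut_den; cbn [fst snd]. ring. Qed.

Lemma aut_den_neq_0 (g : C) (q : C * C) : unit_disk g -> sym_bidisc q -> aut_den g q <> 0.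
Proof.
  intros Hg (z & w & Hz & Hw & ->). rewrite aut_den_sym.
  apply Cmult_neq_0; now apply moebius_den.
Qed.

Lemma aut_sym (g z w : C) : unit_disk g -> unit_disk z -> unit_disk w ->
  aut g (z + w, z * w) = (moebius g z + moebius g w, moebius g z * moebius g w).
Proof.
  intros Hg Hz Hw. unfold aut, aut_s, aut_p. rewrite aut_den_sym. cbn [fst snd].
  pose proof (moebius_den g z Hg Hz). pose proof (moebius_den g w Hg Hw).
  unfold moebius. f_equal; field; split; assumption.
Qed.

Lemma aut_sym_bidisc (g : C) (q : C * C) :
  unit_disk g -> sym_bidisc q -> sym_bidisc (aut g q).
Proof.
  intros Hg (z & w & Hz & Hw & ->). rewrite aut_sym by trivial.
  exists (moebius g z), (moebius g w). auto using moebius_disk.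
Qed.

Lemma aut_inv (g : C) (q : C * C) :
  unit_disk g -> sym_bidisc q -> aut (- g) (aut g q) = q.
Proof.
  intros Hg (z & w & Hz & Hw & ->). rewrite aut_sym by trivial.
  rewrite aut_sym by auto using moebius_disk, unit_disk_opp.
  now rewrite !moebius_inv.
Qed.

Lemma cdiff2_aut_den (g : C) (q : C * C) : cdiff2 (aut_den g) q.
Proof.
  unfold aut_den.
  repeat first [apply cdiff2_plus | apply cdiff2_mult | apply cdiff2_const
               | apply cdiff2_fst | apply cdiff2_snd].
Qed.

Lemma cdiff2_aut_s (g : C) (q : C * C) : aut_den g q <> 0 -> cdiff2 (aut_s g) q.
Proof.
  intro H. unfold aut_s, Cdiv. apply cdiff2_mult.
  - repeat first [apply cdiff2_plus | apply cdiff2_mult | apply cdiff2_const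
                 | apply cdiff2_fst | apply cdiff2_snd].
  - apply (cdiff2_comp Cinv (aut_den g)); [now apply cdiff_Cinv | apply cdiff2_aut_den].
Qed.

Lemma cdiff2_aut_p (g : C) (q : C * C) : aut_den g q <> 0 -> cdiff2 (aut_p g) q.
Proof.
  intro H. unfold aut_p, Cdiv. apply cdiff2_mult.
  - repeat first [apply cdiff2_plus | apply cdiff2_mult | apply cdiff2_const
                 | apply cdiff2_fst | apply cdiff2_snd].
  - apply (cdiff2_comp Cinv (aut_den g)); [now apply cdiff_Cinv | apply cdiff2_aut_den].
Qed.

Lemma cdiff2_comp_aut (F : C * C -> C) (g : C) (q : C * C) :
  aut_den g q <> 0 -> cdiff2 F (aut g q) -> cdiff2 (fun q => F (aut g q)) q.
Proof.
  intros Hd HF. apply (cdiff2_comp2 F (aut_s g) (aut_p g)); trivial.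
  - now apply cdiff2_aut_s.
  - now apply cdiff2_aut_p.
Qed.

(* [tee 0], without the vanishing terms [0 + Cconj 0 * l]. *)
Definition tee0 (q : C * C) : Prop :=
  (exists l, unit_disk l /\ q = (2 * l, l * l)) \/ (exists m, unit_disk m /\ q = (RtoC 0, m)).

Lemma tee0_sym_bidisc (q : C * C) : tee0 q -> sym_bidisc q.
Proof.
  intros [(l & Hl & ->) | (m & Hm & ->)].
  - exists l, l. repeat split; trivial. f_equal; ring.
  - destruct (exists_Csqrt (- m)) as [v Hv].
    assert (Hv1 : unit_disk v).
    { unfold unit_disk in *. apply (f_equal Cmod) in Hv.
      rewrite Cmod_mult, Cmod_opp in Hv. pose proof (Cmod_ge_0 v). nra. }
    exists v, (- v). repeat split; trivial; [now apply unit_disk_opp |].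
    f_equal; [ring |]. replace (v * - v) with (- (v * v)) by ring. rewrite Hv. ring.
Qed.

(** The equation says [moebius g g = beta]: [g] is the hyperbolic midpoint of 0 and [beta]. It is t
    beta with t a root of 1 + b^2 t^2 = 2 t; the form t = 1 / (1 + h) also covers beta = 0. *)
Lemma exists_center (beta : C) : unit_disk beta ->
  exists g, unit_disk g /\ beta * (1 + g * Cconj g) = 2 * g.
Proof.
  unfold unit_disk. intro Hb. set (b := Cmod beta) in *.
  pose proof (Cmod_ge_0 beta) as Hb0. fold b in Hb0.
  set (h := sqrt (1 - b ^ 2)).
  assert (Hh : (h * h = 1 - b ^ 2)%R) by (apply sqrt_sqrt; nra).
  assert (Hh0 : (0 <= h)%R) by apply sqrt_pos.
  set (t := (/ (1 + h))%R).
  assert (Ht : (0 < t <= 1)%R).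
  { unfold t. split; [apply Rinv_0_lt_compat; lra |].
    rewrite <- Rinv_1. apply Rinv_le_contravar; lra. }
  assert (Et : (1 + t * t * b ^ 2 = 2 * t)%R).
  { replace (b ^ 2)%R with (1 - h * h)%R by lra. unfold t. field. lra. }
  exists (RtoC t * beta). split.
  - rewrite Cmod_mult, Cmod_R, Rabs_pos_eq by lra. fold b. nra.
  - rewrite Cmult_conj.
    replace (Cconj (RtoC t)) with (RtoC t)
      by (unfold Cconj, RtoC; simpl; f_equal; ring).
    replace (1 + RtoC t * beta * (RtoC t * Cconj beta)) with
      (1 + RtoC t * RtoC t * (beta * Cconj beta)) by ring.
    rewrite <- Cmod2_conj, <- !RtoC_mult, <- RtoC_plus. fold b. rewrite Et, RtoC_mult. ring.
Qed.

(** The new second coordinate is p = (m + g^2) / (1 + conj(g)^2 m). Multiplied by 1 + g conj(g),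
    beta + conj(beta) p becomes 2 g + 2 conj(g) p, which is the same multiple of the new first
    coordinate. *)
Lemma aut_flat (beta g m : C) : unit_disk g -> unit_disk m ->
  beta * (1 + g * Cconj g) = 2 * g ->
  aut g (RtoC 0, m) = (beta + Cconj beta * moebius (g * g) m, moebius (g * g) m).
Proof.
  intros Hg Hm Hb.
  assert (Hgg : unit_disk (g * g)).
  { unfold unit_disk in *. rewrite Cmod_mult. pose proof (Cmod_ge_0 g). nra. }
  pose proof (moebius_den (g * g) m Hgg Hm) as Hd.
  rewrite Cmult_conj in Hd.
  assert (Hn : 1 + g * Cconj g <> 0).
  { replace (g * Cconj g) with (Cconj g * g) by ring. now apply moebius_den. }
  assert (Eb : beta = 2 * g / (1 + g * Cconj g)) by (rewrite <- Hb; now field).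
  assert (Hcb : Cconj beta * (1 + g * Cconj g) = 2 * Cconj g).
  { apply (f_equal Cconj) in Hb. rewrite !Cmult_conj, Cplus_conj, Cmult_conj, Cconj_conj in Hb.
    replace (Cconj (RtoC 1)) with (RtoC 1) in Hb by (unfold Cconj, RtoC; simpl; f_equal; ring).
    replace (Cconj (RtoC 2)) with (RtoC 2) in Hb by (unfold Cconj, RtoC; simpl; f_equal; ring).
    rewrite <- Hb. ring. }
  assert (Ecb : Cconj beta = 2 * Cconj g / (1 + g * Cconj g)) by (rewrite <- Hcb; now field).
  unfold aut, aut_s, aut_p, aut_den, moebius. cbn [fst snd].
  rewrite Cmult_conj, Ecb, Eb.
  replace (1 + Cconj g * 0 + Cconj g * Cconj g * m) with (1 + Cconj g * Cconj g * m) by ring.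
  f_equal; now field.
Qed.

(** Applying the same map to both coordinates preserves the diagonal z = w, so the royal disk is
    mapped onto itself and only the second disk moves with [beta]. *)
Lemma tee_aut (beta g : C) (q : C * C) : unit_disk g -> beta * (1 + g * Cconj g) = 2 * g ->
  tee beta q <-> exists q0, tee0 q0 /\ q = aut g q0.
Proof.
  intros Hg Hb.
  assert (Hgg : unit_disk (g * g)).
  { unfold unit_disk in *. rewrite Cmod_mult. pose proof (Cmod_ge_0 g). nra. }
  assert (Royal : forall l, unit_disk l ->
    aut g (2 * l, l * l) = (2 * moebius g l, moebius g l * moebius g l)).
  { intros l Hl. replace (2 * l) with (l + l) by ring. rewrite aut_sym by trivial.
    f_equal. ring. }
  assert (Inv : forall h l, unit_disk h -> unit_disk l -> moebius h (moebius (- h) l) = l).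
  { intros h l Hh Hl. rewrite <- (moebius_inv (- h) l) at 2 by auto using unit_disk_opp.
    f_equal. ring. }
  split.
  - intros [(l & Hl & ->) | (l & Hl & ->)].
    + exists (2 * moebius (- g) l, moebius (- g) l * moebius (- g) l).
      pose proof (moebius_disk (- g) l (unit_disk_opp _ Hg) Hl) as Hm.
      split; [left; eauto |]. rewrite Royal, Inv by trivial. reflexivity.
    + exists (RtoC 0, moebius (- (g * g)) l).
      pose proof (moebius_disk (- (g * g)) l (unit_disk_opp _ Hgg) Hl) as Hm.
      split; [right; eauto |]. rewrite (aut_flat beta), Inv by trivial. reflexivity.
  - intros (q0 & [(l & Hl & ->) | (m & Hm & ->)] & ->).
    + left. exists (moebius g l). split; [now apply moebius_disk | now apply Royal].
    + right. exists (moebius (g * g) m).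
      split; [now apply moebius_disk | now apply aut_flat].
Qed.

(** * Nonexistence of the extension operator *)

Lemma sup_norm_le_1 (X Y : C * C -> Prop) (f h : C * C -> C) :
  sup_norm Y h = sup_norm X f -> (forall p, X p -> (Cmod (f p) <= 1)%R) ->
  forall q, Y q -> (Cmod (h q) <= 1)%R.
Proof.
  intros E Hf q Hq. unfold sup_norm in E.
  destruct (Lub_Rbar_correct (fun r => exists p, Y p /\ r = Cmod (h p))) as [H1 _].
  destruct (Lub_Rbar_correct (fun r => exists p, X p /\ r = Cmod (f p))) as [_ H2].
  change (Rbar_le (Cmod (h q)) 1).
  eapply Rbar_le_trans; [apply H1; now exists q |].
  rewrite E. apply H2. intros r (p & Hp & ->). simpl. now apply Hf.
Qed.

(** As [P] is differentiable on all of C^2, its composition with the inverse automorphism serves as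
    its own local extension, off the zeros of the denominator. *)
Lemma Hinf_tee_comp_aut (beta g : C) (a0 : C * C) (P : C * C -> C) (M : R) :
  unit_disk g -> beta * (1 + g * Cconj g) = 2 * g -> sym_bidisc a0 ->
  (forall q, cdiff2 P q) -> (forall q, tee0 q -> (Cmod (P q) <= M)%R) -> P a0 = 0 ->
  Hinf_tee_at beta (aut g a0) (fun q => P (aut (- g) q)).
Proof.
  intros Hg Hb Ha HP HM H0.
  split; [| split].
  - intros q Hq. apply (tee_aut beta g q Hg Hb) in Hq. destruct Hq as (q0 & Hq0 & ->).
    exists (fun q => aut_den (- g) q <> 0), (fun q => P (aut (- g) q)).
    split; [| split; [| split]].
    + apply open_neq_0. intro. apply cdiff2_aut_den.
    + apply aut_den_neq_0; [now apply unit_disk_opp |].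
      now apply aut_sym_bidisc, tee0_sym_bidisc.
    + intros q Hq. apply ex_filterdiff_of_cdiff2. now apply cdiff2_comp_aut.
    + intros q _. reflexivity.
  - exists M. intros q Hq. apply (tee_aut beta g q Hg Hb) in Hq. destruct Hq as (q0 & Hq0 & ->).
    rewrite aut_inv by (trivial; now apply tee0_sym_bidisc). now apply HM.
  - now rewrite aut_inv.
Qed.

(** [fst q / 2] is the parameter l on the royal disk and 0 on the second disk. The factor e1 + e2 l
    leaves room for a zero at a base point on the royal disk. *)
Definition royal_poly (e1 e2 : C) (q : C * C) : C := fst q / 2 * (e1 + e2 * (fst q / 2)).

(** [snd q - (fst q / 2)^2] vanishes on the royal disk and equals m on the second one. The factor 1
    / (1 + |d|) compensates for |m^k - d m| <= 1 + |d|. *)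
Definition flat_poly (d : C) (k : nat) (q : C * C) : C :=
  ((snd q + - (fst q / 2 * (fst q / 2))) ^ k +
    - d * (snd q + - (fst q / 2 * (fst q / 2)))) * / RtoC (1 + Cmod d).

Lemma cdiff2_royal_poly (e1 e2 : C) (q : C * C) : cdiff2 (royal_poly e1 e2) q.
Proof.
  unfold royal_poly, Cdiv.
  repeat first [apply cdiff2_plus | apply cdiff2_mult | apply cdiff2_const
               | apply cdiff2_fst | apply cdiff2_snd].
Qed.

Lemma cdiff2_flat_poly (d : C) (k : nat) (q : C * C) : cdiff2 (flat_poly d k) q.
Proof.
  assert (H : cdiff2 (fun q => snd q + - (fst q / 2 * (fst q / 2))) q).
  { apply cdiff2_plus; [apply cdiff2_snd |].
    apply (cdiff2_comp Copp (fun q => fst q / 2 * (fst q / 2))).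
    - eexists. exists (fun _ => - RtoC 1). split; [apply continuous_const |].
      split; [reflexivity |]. intro; ring.
    - unfold Cdiv. repeat first [apply cdiff2_mult | apply cdiff2_const | apply cdiff2_fst]. }
  unfold flat_poly. apply cdiff2_mult; [| apply cdiff2_const].
  apply cdiff2_plus; [| apply cdiff2_mult; [apply cdiff2_const | exact H]].
  apply (cdiff2_comp (fun w => w ^ k) (fun q => snd q + - (fst q / 2 * (fst q / 2)))); trivial.
  apply cdiff_pow, cdiff_id.
Qed.

Lemma royal_poly_royal (e1 e2 l : C) : royal_poly e1 e2 (2 * l, l * l) = l * (e1 + e2 * l).
Proof. unfold royal_poly; cbn [fst snd]. field. Qed.

Lemma royal_poly_flat (e1 e2 m : C) : royal_poly e1 e2 (RtoC 0, m) = 0.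
Proof. unfold royal_poly; cbn [fst snd]. field. Qed.

Lemma RtoC_1_plus_Cmod_neq_0 (d : C) : RtoC (1 + Cmod d) <> 0.
Proof. intro E. apply RtoC_inj in E. pose proof (Cmod_ge_0 d). lra. Qed.

Lemma flat_poly_royal (d l : C) (k : nat) : (0 < k)%nat -> flat_poly d k (2 * l, l * l) = 0.
Proof.
  intro Hk. unfold flat_poly; cbn [fst snd].
  replace (l * l + - (2 * l / 2 * (2 * l / 2))) with (RtoC 0) by field.
  destruct k as [| k]; [lia |]. rewrite Cpow_S. ring.
Qed.

Lemma flat_poly_flat (d m : C) (k : nat) : flat_poly d k (RtoC 0, m) = (m ^ k - d * m) / RtoC (1 + Cmod d).
Proof.
  unfold flat_poly; cbn [fst snd].
  replace (m + - (0 / 2 * (0 / 2))) with m by field. unfold Cdiv. ring.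
Qed.

(** On each of the two disks one of the functions vanishes, so the norm of the combination is a
    maximum and not a sum. *)
Lemma royal_plus_flat_bound (e1 e2 d w : C) (k : nat) (q : C * C) :
  (0 < k)%nat -> (forall l, unit_disk l -> (Cmod (l * (e1 + e2 * l)) <= 1)%R) ->
  (Cmod w <= 1)%R -> tee0 q -> (Cmod (royal_poly e1 e2 q + w * flat_poly d k q) <= 1)%R.
Proof.
  intros Hk He Hw [(l & Hl & ->) | (m & Hm & ->)].
  - rewrite royal_poly_royal, flat_poly_royal by exact Hk.
    replace (l * (e1 + e2 * l) + w * 0) with (l * (e1 + e2 * l)) by ring. now apply He.
  - rewrite royal_poly_flat, flat_poly_flat, Cplus_0_l, Cmod_mult, Cmod_div by apply RtoC_1_plus_Cmod_neq_0.
    pose proof (Cmod_ge_0 d) as Hd. pose proof (Cmod_ge_0 w). pose proof (Cmod_ge_0 m).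
    rewrite Cmod_R, Rabs_pos_eq by lra.
    assert (Hv : (Cmod (m ^ k - d * m) <= 1 + Cmod d)%R).
    { unfold Cminus. eapply Rle_trans; [apply Cmod_triangle |].
      rewrite Cmod_opp, Cmod_pow, Cmod_mult. unfold unit_disk in Hm.
      assert (Cmod m ^ k <= 1)%R by (rewrite <- (pow1 k); apply pow_incr; lra).
      nra. }
    assert (Hq : (Cmod (m ^ k - d * m) / (1 + Cmod d) <= 1)%R) by (apply Rle_div_l; lra).
    assert (0 <= Cmod (m ^ k - d * m) / (1 + Cmod d))%R.
    { apply Rmult_le_pos; [apply Cmod_ge_0 | left; apply Rinv_0_lt_compat; lra]. }
    nra.
Qed.

Lemma extension_bound (beta g : C) (a0 : C * C) (L : (C * C -> C) -> C * C -> C)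
    (e1 e2 d : C) (k : nat) (r : R) :
  linear_isometric_extension beta (aut g a0) L ->
  unit_disk g -> beta * (1 + g * Cconj g) = 2 * g -> tee0 a0 ->
  (2 <= k)%nat -> (1 / 2 <= r < 1)%R ->
  (forall l, unit_disk l -> (Cmod (l * (e1 + e2 * l)) <= 1)%R) ->
  royal_poly e1 e2 a0 = 0 -> flat_poly d k a0 = 0 ->
  (Cmod e1 ^ 2 * r ^ (2 * k) * (1 / r - r) ^ 2 <= 512 * Cmod d)%R.
Proof.
  intros HL Hg Hb Ha Hk Hr He HA0 HB0.
  pose proof (tee0_sym_bidisc _ Ha) as Hga.
  set (f := fun q => royal_poly e1 e2 (aut (- g) q)).
  set (h := fun q => flat_poly d k (aut (- g) q)).
  assert (Hf : Hinf_tee_at beta (aut g a0) f).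
  { apply Hinf_tee_comp_aut with 1%R; trivial; [intro; apply cdiff2_royal_poly |].
    intros q Hq. replace (royal_poly e1 e2 q) with (royal_poly e1 e2 q + 0 * flat_poly d k q) by ring.
    apply royal_plus_flat_bound; trivial; [lia | rewrite Cmod_0; lra]. }
  assert (Hh : forall w, (Cmod w <= 1)%R ->
    Hinf_tee_at beta (aut g a0) (fun q => w * h q)).
  { intros w Hw.
    apply (Hinf_tee_comp_aut beta g a0 (fun q => w * flat_poly d k q) 1); trivial.
    - intro q. apply cdiff2_mult; [apply cdiff2_const | apply cdiff2_flat_poly].
    - intros q Hq. replace (w * flat_poly d k q) with (royal_poly 0 0 q + w * flat_poly d k q)
        by (unfold royal_poly; ring).
      apply royal_plus_flat_bound; trivial; [lia |]. intros l _.
      replace (l * (0 + 0 * l)) with (RtoC 0) by ring. rewrite Cmod_0. lra.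
    - rewrite HB0. ring. }
  assert (Hh1 : Hinf_tee_at beta (aut g a0) h).
  { apply (Hinf_tee_comp_aut beta g a0 (flat_poly d k) 1); trivial; [intro; apply cdiff2_flat_poly |].
    intros q Hq. replace (flat_poly d k q) with (royal_poly 0 0 q + 1 * flat_poly d k q) by (unfold royal_poly; ring).
    apply royal_plus_flat_bound; trivial; [lia | | rewrite Cmod_1; lra]. intros l _.
    replace (l * (0 + 0 * l)) with (RtoC 0) by ring. rewrite Cmod_0. lra. }
  assert (Hfh : forall w, (Cmod w <= 1)%R ->
    Hinf_tee_at beta (aut g a0) (fun q => f q + w * h q)).
  { intros w Hw.
    apply (Hinf_tee_comp_aut beta g a0 (fun q => royal_poly e1 e2 q + w * flat_poly d k q) 1); trivial.
    - intro q. apply cdiff2_plus; [apply cdiff2_royal_poly |].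
      apply cdiff2_mult; [apply cdiff2_const | apply cdiff2_flat_poly].
    - intros q Hq. apply royal_plus_flat_bound; trivial. lia.
    - rewrite HA0, HB0. ring. }
  assert (Tee : forall q0, tee0 q0 -> tee beta (aut g q0)).
  { intros q0 Hq0. apply (tee_aut beta g); trivial. now exists q0. }
  assert (Hol : forall u, Hinf_tee_at beta (aut g a0) u ->
    cdiff2_on sym_bidisc (fun q => L u (aut g q))).
  { intros u Hu q Hq. apply cdiff2_comp_aut; [now apply aut_den_neq_0 |].
    apply cdiff2_of_ex_filterdiff. destruct (lie_maps _ _ _ HL u Hu) as [Hhol _].
    now apply Hhol, aut_sym_bidisc. }
  assert (Ext : forall P q0, Hinf_tee_at beta (aut g a0) (fun q => P (aut (- g) q)) ->
    tee0 q0 -> L (fun q => P (aut (- g) q)) (aut g q0) = P q0).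
  { intros P q0 HP Hq0. rewrite (lie_restr _ _ _ HL _ HP) by now apply Tee.
    rewrite aut_inv by (trivial; now apply tee0_sym_bidisc). reflexivity. }
  apply (coupled_extensions_bound (fun q => L f (aut g q)) (fun q => L h (aut g q))
    e1 e2 d k r); trivial.
  - now apply Hol.
  - now apply Hol.
  - intros q Hq.
    (* The rotation [w] depends on the point, but linearity and isometry give |L f + w L h| <= 1 on
       the whole domain for each fixed [w]. *)
    destruct (exists_aligning_rotation (L f (aut g q)) (L h (aut g q))) as (w & Hw & <-).
    assert (Hw1 : (Cmod w <= 1)%R) by lra.
    pose proof (aut_sym_bidisc g q Hg Hq) as Hgq.
    pose proof (lie_add _ _ _ HL f _ Hf (Hh w Hw1) _ Hgq) as E1.
    pose proof (lie_scal _ _ _ HL w h Hh1 _ Hgq) as E2.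
    cbv beta in E1, E2. rewrite <- E2, <- E1.
    apply (sup_norm_le_1 (tee beta) sym_bidisc (fun q => f q + w * h q)); trivial.
    + now apply (lie_isometric _ _ _ HL), Hfh.
    + intros p Hp. apply (tee_aut beta g p Hg Hb) in Hp. destruct Hp as (q0 & Hq0 & ->).
      unfold f, h. rewrite aut_inv by (trivial; now apply tee0_sym_bidisc).
      apply royal_plus_flat_bound; trivial. lia.
  - intros l Hl. rewrite <- royal_poly_royal. apply (Ext (royal_poly e1 e2)); trivial. left; eauto.
  - intros m Hm. rewrite <- flat_poly_flat. apply (Ext (flat_poly d k)); trivial. right; eauto.
Qed.

Lemma no_extension (beta g : C) (a0 : C * C) (L : (C * C -> C) -> C * C -> C) (e1 e2 m : C) :
  linear_isometric_extension beta (aut g a0) L ->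
  unit_disk g -> beta * (1 + g * Cconj g) = 2 * g -> tee0 a0 ->
  e1 <> 0 -> (forall l, unit_disk l -> (Cmod (l * (e1 + e2 * l)) <= 1)%R) ->
  unit_disk m -> royal_poly e1 e2 a0 = 0 ->
  (forall k, (2 <= k)%nat -> flat_poly (m ^ (k - 1)) k a0 = 0) -> False.
Proof.
  intros HL Hg Hb Ha He0 He Hm HA HB.
  unfold unit_disk in Hm. pose proof (Cmod_ge_0 m) as Hm0.
  (* This choice works because r^2 - |m| = (1 - |m|)^2 / 4 > 0. *)
  set (r := ((1 + Cmod m) / 2)%R).
  assert (Hr : (1 / 2 <= r < 1)%R) by (unfold r; lra).
  assert (Hrm : (Cmod m < r ^ 2)%R) by (unfold r; nra).
  set (c := (Cmod e1 ^ 2 * (1 / r - r) ^ 2)%R).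
  assert (Hc : (0 < c)%R).
  { unfold c. assert (1 < 1 / r)%R by (apply Rlt_div_r; lra).
    apply Cmod_gt_0 in He0. apply Rmult_lt_0_compat; apply pow_lt; lra. }
  assert (Hr2 : (0 < r ^ 2)%R) by (apply pow_lt; lra).
  set (x := (Cmod m / r ^ 2)%R).
  assert (Hx : (0 <= x < 1)%R).
  { unfold x. split; [apply Rmult_le_pos; trivial; left; now apply Rinv_0_lt_compat |].
    apply Rlt_div_l; lra. }
  (* With k = n + 2 and d = m^(n+1), dividing the bound by (r^2)^(n+1) leaves c r^2 <= 512 x^(n+1),
     where x < 1. *)
  destruct (pow_lt_1_zero x ltac:(rewrite Rabs_pos_eq; lra) (c * r ^ 2 / 512)) as [n Hn].
  { apply Rdiv_lt_0_compat; [now apply Rmult_lt_0_compat | lra]. }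
  specialize (Hn (S n) ltac:(lia)).
  rewrite Rabs_pos_eq in Hn by (apply pow_le; lra).
  pose proof (extension_bound beta g a0 L e1 e2 (m ^ (S n)) (S (S n)) r HL Hg Hb Ha
    ltac:(lia) Hr He HA) as K.
  specialize (HB (S (S n)) ltac:(lia)). replace (S (S n) - 1)%nat with (S n) in HB by lia.
  specialize (K HB). rewrite Cmod_pow in K.
  assert (E : (Cmod m ^ S n = x ^ S n * (r ^ 2) ^ S n)%R).
  { rewrite <- Rpow_mult_distr. f_equal. unfold x. field. lra. }
  rewrite E, pow_mult in K. change ((r ^ 2) ^ S (S n))%R with (r ^ 2 * (r ^ 2) ^ S n)%R in K.
  assert (Hp : (0 < (r ^ 2) ^ S n)%R) by now apply pow_lt.
  set (p := ((r ^ 2) ^ S n)%R) in *. set (y := (x ^ S n)%R) in *.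
  assert (K2 : (c * r ^ 2 * p <= 512 * y * p)%R) by (unfold c; lra).
  apply Rmult_le_reg_r in K2; [| exact Hp]. lra.
Qed.

Theorem theorem5p1 : forall (beta : C) (a : C * C),
  unit_disk beta -> tee beta a ->
  ~ exists L : (C * C -> C) -> (C * C -> C), linear_isometric_extension beta a L.
Proof.
  intros beta a Hbeta Ha [L HL].
  destruct (exists_center beta Hbeta) as (g & Hg & Hb).
  apply (tee_aut beta g a Hg Hb) in Ha. destruct Ha as (a0 & Ha0 & ->).
  assert (Flat : forall m, unit_disk m -> a0 = (RtoC 0, m) -> False).
  { intros m Hm E.
    (* The coordinate l itself vanishes on the second disk, hence at the base point; [d] is m^(k-1)
       because m^k - d m has to vanish there too. *)
    apply (no_extension beta g a0 L 1 0 m); trivial.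
    - apply C1_nz.
    - intros l Hl. replace (l * (1 + 0 * l)) with l by ring. left; exact Hl.
    - rewrite E. apply royal_poly_flat.
    - intros k Hk. rewrite E, flat_poly_flat.
      replace (m ^ k) with (m ^ (k - 1) * m).
      + unfold Cdiv, Cminus. ring.
      + rewrite Cmult_comm, <- Cpow_S. f_equal. lia. }
  destruct Ha0 as [(l & Hl & El) | (m & Hm & Em)]; [| now apply (Flat m)].
  (* For l = 0 the base point is the common point (0, 0) of the two disks, and it is treated as a
     point of the second one. *)
  destruct (Ceq_dec l 0) as [-> | Hl0].
  { apply (Flat 0); [unfold unit_disk; rewrite Cmod_0; lra |].
    rewrite El. f_equal; ring. }
  apply (no_extension beta g a0 L (l / 2) (- / 2) 0); trivial.
  - left; eauto.
  - intro E. apply Hl0. replace l with (2 * (l / 2)) by field. rewrite E. ring.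
  - intros z Hz. unfold unit_disk in *.
    replace (z * (l / 2 + - / 2 * z)) with (z * ((l + - z) * RtoC (/ 2)))
      by (rewrite RtoC_inv by lra; field).
    rewrite !Cmod_mult, Cmod_R, Rabs_pos_eq by lra.
    pose proof (Cmod_triangle l (- z)) as T. rewrite Cmod_opp in T.
    pose proof (Cmod_ge_0 z). pose proof (Cmod_ge_0 (l + - z)). nra.
  - unfold unit_disk. rewrite Cmod_0. lra.
  - rewrite El, royal_poly_royal. field.
  - intros k Hk. rewrite El. apply flat_poly_royal. lia.
Qed.
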